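(* Let $d=1$, let $W$ be an admissible interaction potential, let $\mu^0\in\mathscr{P}$ have compact support and let $T>0$. Let $\mu$ be the gradient flow solution of the interaction system with initial datum $\mu^0$. Then there exists a constant $K=K(T,\mu^0)>0$ such that for all $t\in[0,T]$ and all $i\in\{1,\ldots,n\}$: $$\operatorname{supp}\mu_i(t)\subset[-K,K].$$
   Context: Spatial dimension $d=1$. Let $n\in\mathbb{N}$, $m_1,\ldots,m_n>0$, $p_1,\ldots,p_n>0$, $E\in\mathbb{R}$ be fixed. Admissible interaction potential: a map $W:\mathbb{R}\to\mathbb{R}^{n\times n}$ such that $W(z)$ is a symmetric matrix for each $z$; $W_{ij}\in C^1(\mathbb{R};\mathbb{R})$ for all $i,j$; $W(z)=W(-z)$ for all $z$; there is a matrix $\overline W\in\mathbb{R}^{n\times n}$ with $|W_{ij}(z)|\le\overline W_{ij}(1+|z|^2)$ for all $z,i,j$; and there is a symmetric matrix $\kappa\in\mathbb{R}^{n\times n}$ such that $z\mapsto W_{ij}(z)-\frac12\kappa_{ij}|z|^2$ is convex for all $i,j$. Interaction system: $\partial_t\mu_i=\partial_x\big[m_i\mu_i\,\partial_x\big(\sum_{j=1}^nW_{ij}*\mu_j\big)\big]$, $i=1,\ldots,n$; it holds in the sense of distributions if for all $i$ and all $\varphi\in C_c^\infty((0,\infty)\times\mathbb{R})$: $\int_0^\infty\int_{\mathbb{R}}\big(\partial_t\varphi(t,x)-m_i\partial_x\varphi(t,x)\sum_{j=1}^n\int W_{ij}'(x-y)\,\mathrm{d}\mu_j(t,y)\big)\mathrm{d}\mu_i(t,x)\,\mathrm{d}t=0$.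 $\mathscr{P}$ is the set of $n$-tuples $\mu=(\mu_1,\ldots,\mu_n)$ of nonnegative Borel measures on $\mathbb{R}$ with $\mu_j(\mathbb{R})=p_j$, finite second moments, and $\sum_{j=1}^n\frac1{m_j}\int_{\mathbb{R}}x\,\mathrm{d}\mu_j(x)=E$, with the distance $$\mathbf{W}_{\mathscr{P}}(\mu^0,\mu^1)=\Big[\sum_{j=1}^n\frac1{m_j}\inf\Big\{\int|x-y|^2\,\mathrm{d}\gamma_j(x,y):\gamma_j\in\Gamma(\mu^0_j,\mu^1_j)\Big\}\Big]^{1/2},$$ where $\Gamma(\mu^0_j,\mu^1_j)$ is the set of finite Borel measures on $\mathbb{R}\times\mathbb{R}$ with marginals $\mu_j^0,\mu_j^1$. ''$\mu^0$ has compact support'' means every component has compact support. $AC^2_{\mathrm{loc}}([0,\infty);(X,\mathbf{d}))$ is the set of curves $\mu:[0,\infty)\to X$ such that for each $T>0$ there is $\varphi\in L^2([0,T])$ with $\mathbf{d}(\mu(s),\mu(t))\le\int_s^t\varphi(r)\,\mathrm{d}r$ for $0\le s\le t\le T$. The gradient flow solution with initial datum $\mu^0\in\mathscr{P}$ is the (existing and unique) curve in $AC^2_{\mathrm{loc}}([0,\infty);(\mathscr{P},\mathbf{W}_{\mathscr{P}}))$ with $\mu(0)=\mu^0$ for which the interaction system holds in the sense of distributions. *)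

(* Defs.v *)
From HB Require Import structures.
From mathcomp Require Import all_boot all_order all_algebra.
From mathcomp Require Import all_classical all_reals all_analysis.

Set Implicit Arguments.
Unset Strict Implicit.
Unset Printing Implicit Defensive.
Import Order.TTheory GRing.Theory Num.Theory.
Import numFieldNormedType.Exports.

Local Open Scope classical_set_scope.
Local Open Scope ring_scope.

Notation borelMeasure R := {measure set (measurableTypeR R) -> \bar R}.

Section Measures.
Context {R : realType}.

Definition supp (mu : borelMeasure R) : set R :=
  [set x | forall U : set R, open_nbhs x U -> (0 < mu U)%E].

Definition couplings (mu nu : borelMeasure R) :
    set {finite_measure set ((measurableTypeR R * measurableTypeR R)%type) -> \bar R} :=
  [set gamma | forall A : set (measurableTypeR R), measurable A ->
     pushforward gamma fst A = mu A /\ pushforward gamma snd A = nu A].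

Definition transport_cost (mu nu : borelMeasure R) : \bar R :=
  ereal_inf [set (\int[gamma]_z (`|z.1 - z.2| ^+ 2)%:E)%E
            | gamma in couplings mu nu].

End Measures.

Section System.
Context {R : realType} {n : nat}.
Implicit Types (m p : 'I_n -> R) (W : R -> 'M[R]_n).
Implicit Types (mu nu : 'I_n -> borelMeasure R).

Record admissible W : Prop := {
  adm_sym : forall z, (W z)^T = W z;
  adm_C1 : forall i j,
    (forall z : R, derivable (fun y : R => W y i j) z 1) /\
    continuous (derive1 (fun y : R => W y i j));
  adm_even : forall z, W z = W (- z);
  adm_growth : exists Wbar : 'M[R]_n,
    forall z i j, `|W z i j| <= Wbar i j * (1 + `|z| ^+ 2);
  adm_convex : exists kappa : 'M[R]_n, kappa^T = kappa /\
    forall i j, convex_function (E := R^o) setT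
      (fun z : R => W z i j - 2^-1 * kappa i j * `|z| ^+ 2)
}.

Record phase_space m p (E : R) mu : Prop := {
  ps_mass : forall j, mu j setT = (p j)%:E;
  ps_moment2 : forall j, (\int[mu j]_x (`|x| ^+ 2)%:E < +oo)%E;
  ps_center : \sum_(j < n) (m j)^-1 * (\int[mu j]_x x) = E
}.

(* On [phase_space] the infima are finite, so [fine] loses nothing there. *)
Definition WP m mu nu : R :=
  Num.sqrt (\sum_(j < n) (m j)^-1 * fine (transport_cost (mu j) (nu j))).

End System.

Section Curves.
Context {R : realType}.

Definition L2_itv (T : R) (phi : R -> R) : Prop :=
  measurable_fun `[0, T] phi /\
  (\int[lebesgue_measure]_(r in `[0%R, T]) (`|phi r| ^+ 2)%:E < +oo)%E.

(* Curves [0, +oo) -> X are total maps whose values at negative times play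
   no role; the metric space is the subset [X] of [M] with distance [d]. *)
Definition AC2_loc (M : Type) (X : set M) (d : M -> M -> R) (c : R -> M) : Prop :=
  (forall t, 0 <= t -> X (c t)) /\
  forall T, 0 < T -> exists2 phi : R -> R, L2_itv T phi &
    forall s t, 0 <= s -> s <= t -> t <= T ->
      d (c s) (c t) <= \int[lebesgue_measure]_(r in `[s, t]) phi r.

End Curves.

Section TestFunctions.
Context {R : realType}.
Implicit Types phi : R * R -> R.

Definition dt phi : R * R -> R := fun z => 'D_(1, 0) phi z.
Definition dx phi : R * R -> R := fun z => 'D_(0, 1) phi z.

Fixpoint Ck (k : nat) phi : Prop :=
  continuous phi /\
  if k is k'.+1 then
    [/\ forall z, derivable phi z (1, 0) /\ derivable phi z (0, 1),
        Ck k' (dt phi) & Ck k' (dx phi)]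
  else True.

(* Elements of C_c^oo((0, +oo) x R), identified with their extension by zero
   to R x R; the first coordinate is time. *)
Record test_function phi : Prop := {
  tf_smooth : forall k, Ck k phi;
  tf_compact : compact (closure [set z | phi z != 0]);
  tf_domain : closure [set z | phi z != 0] `<=` [set z | 0 < z.1]
}.

End TestFunctions.

Section GradientFlow.
Context {R : realType} {n : nat}.
Implicit Types (m p : 'I_n -> R) (W : R -> 'M[R]_n).

Definition weak_solution m W (mu : R -> 'I_n -> borelMeasure R) : Prop :=
  forall (i : 'I_n) (phi : R * R -> R), test_function phi ->
    \int[lebesgue_measure]_(t in `]0, +oo[)
      (\int[mu t i]_x
        (dt phi (t, x) -
         m i * dx phi (t, x) *
         \sum_(j < n) \int[mu t j]_y derive1 (fun z : R => W z i j) (x - y)))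
    = 0.

(* The initial condition is equality as Borel measures: the values of a
   library measure outside the sigma-algebra are irrelevant. *)
Record gradient_flow m p (E : R) W (mu0 : 'I_n -> borelMeasure R)
    (mu : R -> 'I_n -> borelMeasure R) : Prop := {
  gf_AC : AC2_loc (phase_space m p E) (WP m) mu;
  gf_init : forall j (A : set (measurableTypeR R)), measurable A ->
    mu 0 j A = mu0 j A;
  gf_weak : weak_solution m W mu
}.

End GradientFlow.

(* Main.v *)
(* Write s(t) = (1 + M) exp(B t), where M bounds the initial supports. Convexity,
   quadratic growth and evenness give |W_ij'(z)| <= C (1 + |z|), so if the first
   moments are at most p_j lam s(t), then the velocity at a point |x| > th s(t)
   is at most B |x| whenever th >= 1 and lam <= 2 th. Testing the equation with a
   cutoff of exp(-2 B t) x^2 then shows that the mass inside |x| <= th s(t) cannot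
   decrease, so no mass ever crosses |x| = th s(t), and the first moments are in
   fact at most p_j th s(t). Finite transport distance to the initial datum
   provides some lam = 2^k, depending on the solution; halving it k times reaches
   th = 1, and the resulting bound no longer depends on the solution. *)

From HB Require Import structures.
Require Import Defs.
From mathcomp Require Import all_boot all_order all_algebra.
From mathcomp Require Import all_classical all_reals all_analysis.
From mathcomp Require Import measurable_realfun ring lra.
Import Order.TTheory GRing.Theory Num.Theory.
Import numFieldNormedType.Exports.
Local Open Scope classical_set_scope.
Local Open Scope ring_scope.

Set Implicit Arguments.
Unset Strict Implicit.
Unset Printing Implicit Defensive.

(** * Smooth flat functions *)

(** [K] is fixed before the solution is given, so the rate [B] may depend on the data only, while
    the a priori moment bound depends on the curve. The two decouple because the velocity is
    estimated only beyond the front, where 1, [|x|] and the moment bound are all controlled by [|x|]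
    with constants free of [th]. The level sets of the cutoff move outward at speed [B |x|], at
    least as fast as the drift, so apart from its time window the test function can only grow along
    the flow. The weak equation says nothing at time 0 or at a single later time, since test
    functions vanish near the ends of their time support. What links the time windows to the two end
    times is uniform continuity of integrals of Lipschitz functions along the curve, extracted from
    the transport distance by the easy half of Kantorovich duality. Integrands produced by the
    equation are only squeezed between integrable functions. *)

Definition flatp {R : realType} (p : {poly R}) (x : R) : R :=
  if 0 < x then p.[x^-1] * expR (- x^-1) else 0.

Definition flat {R : realType} : R -> R := flatp 1%:P.

Section Flat.
Context {R : realType}.
Implicit Types (p : {poly R}) (x y : R).

(** Each monomial obeys [y ^ k <= k! * expR y], so the bound is summed coefficient by
    coefficient. *)
Lemma horner_expRN_bounded p :
  exists2 C : R, 0 <= C & forall y, 0 <= y -> `|p.[y] * expR (- y)| <= C.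
Proof.
exists (\sum_(i < size p) `|p`_i| * i`!%:R).
  by apply: sumr_ge0 => i _; rewrite mulr_ge0.
move=> y y0; rewrite horner_coef normrM (ger0_norm (expR_ge0 _)).
rewrite expRN ler_pdivrMr ?expR_gt0//.
apply: (le_trans (ler_norm_sum _ _ _)).
rewrite mulr_suml; apply: ler_sum => i _; rewrite normrM -mulrA ler_wpM2l//.
rewrite ger0_norm ?exprn_ge0//.
case: (nat_of_ord i) => [|k].
  by rewrite expr0 fact0 mul1r -expR0 ler_expR.
rewrite mulrC -ler_pdivrMr ?ltr0n ?fact_gt0//.
by apply: le_trans (expR_ge1Dxn k y0); rewrite lerDr.
Qed.

Lemma is_derive0_quadratic (f : R -> R) (C : R) :
  (forall h, `|f h| <= C * h ^+ 2) -> is_derive (0 : R) 1 f 0.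
Proof.
move=> fC.
have f0 : f 0 = 0.
  by apply/normr0_eq0/eqP; rewrite eq_le normr_ge0 andbT (le_trans (fC 0))// expr0n mulr0.
have C0 : 0 <= C by have := le_trans (normr_ge0 _) (fC 1); rewrite expr1n mulr1.
have Cp : 0 < C + 1 by rewrite ltr_wpDl.
have key : h^-1 *: (f (h *: 1 + 0) - f 0) @[h --> (0 : R)^'] --> (0 : R).
  apply/cvgr0Pnorm_lt => e e0.
  near=> h.
  have h0 : h != 0 by near: h; exact: nbhs_dnbhs_neq.
  rewrite f0 subr0 addr0 /GRing.scale/= mulr1 normrM normfV.
  rewrite mulrC ltr_pdivrMr ?normr_gt0//.
  apply: (le_lt_trans (fC h)).
  rewrite -real_normK ?num_real// expr2 mulrA ltr_pM2r ?normr_gt0//.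
  have he : `|h| < e / (C + 1).
    near: h; apply: dnbhs0_lt; exact: divr_gt0.
  apply: (@le_lt_trans _ _ ((C + 1) * `|h|)).
    by rewrite ler_wpM2r// lerDl.
  by rewrite mulrC -ltr_pdivlMr.
split; first by apply/cvg_ex; exists 0.
exact: cvg_lim key.
Unshelve. all: by end_near. Qed.

(** The functions [p(1/x) exp(-1/x)] are closed under differentiation, which reduces smoothness of
    [flat] to this one formula. Away from 0 it is the chain rule; at 0 the function is quadratically
    small. *)
Lemma is_derive_flatp p x :
  is_derive x 1 (flatp p) (flatp ((p - p^`()) * 'X^2) x).
Proof.
have [x0|x0|x0] := ltrgtP x 0.
- rewrite {2}/flatp ltNge ltW//=.
  apply: (@near_eq_is_derive _ _ _ (cst 0)).
  near=> y; rewrite /flatp/= ltNge ltW//=.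
  by near: y; exact: lt_nbhsl.
- pose g y : R := p.[y^-1] * expR (- y^-1).
  apply: (@near_eq_is_derive _ _ _ g).
    near=> y; rewrite /flatp.
    have -> // : 0 < y by near: y; exact: lt_nbhsr.
  have xN0 : x != 0 by rewrite gt_eqF.
  have dinv : is_derive x 1 (fun y : R => y^-1) (- x ^- 2).
    apply: is_derive_eq; first exact: (@is_deriveV _ id).
    by rewrite /GRing.scale/= mulr1.
  have dp : is_derive x 1 (fun y : R => p.[y^-1]) (p^`().[x^-1] * - x ^- 2).
    have dh : is_derive x^-1 1 (horner p) p^`().[x^-1].
      rewrite derivE derive1E.
      exact/derivableP/derivable_horner.
    exact: (@is_derive1_comp _ (horner p) (fun y => y^-1) _ _ _ dh dinv).
  have de : is_derive x 1 (fun y : R => expR (- y^-1)) (expR (- x^-1) * x ^- 2).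
    apply: (@is_derive1_comp _ expR (fun y => - y^-1)).
    by apply: is_derive_eq; rewrite opprK.
  apply: is_derive_eq.
  rewrite /flatp x0 !hornerE /GRing.scale/=.
  by field.
- rewrite x0 {2}/flatp ltxx.
  (* Bounding [p * 'X^2] instead of [p] at [h^-1] yields the factor [h ^+ 2]. *)
  have [C C0 CP] := horner_expRN_bounded (p * 'X^2).
  apply: (@is_derive0_quadratic _ C) => h; rewrite /flatp.
  case: ifPn => [h0|_]; last by rewrite normr0 mulr_ge0// sqr_ge0.
  have := CP h^-1; rewrite invr_ge0 ltW// => /(_ isT).
  rewrite hornerM hornerXn exprVn -mulrA [_ * expR _]mulrC mulrA normrM.
  by rewrite [X in _ * X]ger0_norm ?invr_ge0 ?sqr_ge0// ler_pdivrMr// exprn_gt0.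
Unshelve. all: by end_near. Qed.

Lemma derivable_flatp p x : derivable (flatp p) x 1.
Proof. by have [] := is_derive_flatp p x. Qed.

Lemma derive1_flatp p : derive1 (flatp p) = flatp ((p - p^`()) * 'X^2).
Proof. by apply/funext => x; rewrite derive1E; have [] := is_derive_flatp p x. Qed.

Lemma smooth_flat (k : nat) x : derivable (derive1n k flat) x 1.
Proof.
suff [p ->] : exists p, derive1n k (@flat R) = flatp p by exact: derivable_flatp.
elim: k => [|k [p IH]]; first by exists 1%:P.
by exists ((p - p^`()) * 'X^2); rewrite derive1nS IH derive1_flatp.
Qed.

Lemma derive1_flat : derive1 flat = flatp 'X^2 :> (R -> R).
Proof. by rewrite derive1_flatp derivC subr0 mul1r. Qed.

Lemma flat_le0 x : x <= 0 -> flat x = 0.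
Proof. by move=> x0; rewrite /flat /flatp ltNge x0. Qed.

Lemma flat_gt0E x : 0 < x -> flat x = expR (- x^-1).
Proof. by move=> x0; rewrite /flat /flatp x0 hornerC mul1r. Qed.

Lemma flat_gt0 x : 0 < x -> 0 < flat x.
Proof. by move=> x0; rewrite flat_gt0E// expR_gt0. Qed.

Lemma flat_ge0 x : 0 <= flat x.
Proof. by have [/flat_le0 ->//|/flat_gt0/ltW] := leP x 0. Qed.

Lemma flat_le1 x : flat x <= 1.
Proof.
have [/flat_le0 ->//|x0] := leP x 0.
by rewrite flat_gt0E// -[leRHS]expR0 ler_expR oppr_le0 invr_ge0 ltW.
Qed.

Lemma flat_homo : {homo (@flat R) : x y / x <= y}.
Proof.
move=> x y xy; have [/flat_le0 ->|x0] := leP x 0; first exact: flat_ge0.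
have y0 := lt_le_trans x0 xy.
by rewrite !flat_gt0E// ler_expR lerN2 lef_pV2.
Qed.

Lemma flat_lt x y : x < y -> 0 < y -> flat x < flat y.
Proof.
move=> xy y0; have [/flat_le0 ->|x0] := leP x 0; first exact: flat_gt0.
by rewrite !flat_gt0E// ltr_expR ltrN2 ltf_pV2.
Qed.

Lemma derive1_flat_ge0 x : 0 <= derive1 (@flat R) x.
Proof.
rewrite derive1_flat /flatp; case: ifP => // _.
by rewrite hornerXn mulr_ge0 ?sqr_ge0 ?expR_ge0.
Qed.

Lemma derive1_flat_le0 x : x <= 0 -> derive1 flat x = 0.
Proof. by move=> x0; rewrite derive1_flat /flatp ltNge x0. Qed.

Lemma derive1_flat_le2 x : derive1 flat x <= 2.
Proof.
rewrite derive1_flat /flatp; case: ifP => // x0.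
rewrite hornerXn expRN ler_pdivrMr ?expR_gt0// mulrC -ler_pdivrMr//.
have xi0 : 0 <= x^-1 by rewrite invr_ge0 ltW.
by apply: le_trans (expR_ge1Dxn 1 xi0); rewrite lerDr.
Qed.

Lemma is_derive_flat x : is_derive x 1 flat (derive1 flat x).
Proof. by rewrite derive1_flat; apply: is_derive_eq (is_derive_flatp _ _) _; rewrite derivC subr0 mul1r. Qed.

Lemma continuous_flat : continuous (@flat R).
Proof. by move=> x; apply/differentiable_continuous/derivable1_diffP/derivable_flatp. Qed.

End Flat.

(** * Smooth functions of two variables *)

Section Smooth.
Context {R : realType}.
Implicit Types (phi psi : R * R -> R) (z v : R * R).

(** Restriction to a line turns a directional derivative into a one-variable one, so the
    one-variable chain rule applies with derivability along [v] alone. *)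
Lemma is_derive_line phi z v :
  derivable phi z v ->
  is_derive (0 : R) 1 (fun h : R => phi (h *: v + z)) ('D_v phi z).
Proof.
move=> dphi; split; first exact: (derivable1P phi z v).1.
rewrite /derive.
set F := (X in lim (X @ _)); set G := (X in _ = lim (X @ _)).
suff -> : F = G by [].
apply/funext => h; rewrite /F /G.
by rewrite /= scale0r add0r addr0 [h *: 1]mulr1.
Qed.

Lemma is_derive_comp_line (f : R -> R) phi z v :
  derivable f (phi z) 1 -> derivable phi z v ->
  is_derive z v (f \o phi) (derive1 f (phi z) * 'D_v phi z).
Proof.
move=> df dphi.
have dl := is_derive_line dphi.
have df' : is_derive (phi ((0 : R) *: v + z)) 1 f (derive1 f (phi z)).
  rewrite scale0r add0r derive1E; exact: derivableP df.
have dc : is_derive (0 : R) 1 (fun h : R => (f \o phi) (h *: v + z))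
    (derive1 f (phi z) * 'D_v phi z) := is_derive1_comp df' dl.
have dfphi : derivable (f \o phi) z v by apply: (derivable1P _ _ _).2; have [] := dc.
split => //.
have [_ <-] := is_derive_line dfphi.
by have [_ ->] := dc.
Qed.

Lemma CkS k phi : Ck k.+1 phi -> Ck k phi.
Proof.
elim: k phi => [|k IH] phi; first by case.
by move=> [cphi [dphi /IH Ht /IH Hx]]; split.
Qed.

Lemma Ck_cst k (c : R) : Ck k (cst c).
Proof.
elim: k c => [|k IH] c; first by split=> //; exact: cst_continuous.
split; first exact: cst_continuous.
have d0 v : (fun z => 'D_v (cst c) z) = cst 0.
  by apply/funext => z; rewrite derive_cst.
by split; [move=> z; split; exact: derivable_cst|rewrite /dt d0|rewrite /dx d0].
Qed.

Lemma CkD k phi psi : Ck k phi -> Ck k psi -> Ck k (phi \+ psi).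
Proof.
elim: k phi psi => [|k IH] phi psi.
  move=> [cphi _] [cpsi _]; split => //.
  by move=> z; apply: (@continuousD _ R^o); [exact: cphi|exact: cpsi].
move=> [cphi [dphi tphi xphi]] [cpsi [dpsi tpsi xpsi]]; split.
  by move=> z; apply: (@continuousD _ R^o); [exact: cphi|exact: cpsi].
split.
- move=> z; have [p1 p2] := dphi z; have [q1 q2] := dpsi z.
  split; [exact: (derivableD p1 q1)|exact: (derivableD p2 q2)].
- have -> : dt (phi \+ psi) = dt phi \+ dt psi; last exact: IH.
  apply/funext => z; have [? ?] := dphi z; have [? ?] := dpsi z.
  exact: deriveD.
- have -> : dx (phi \+ psi) = dx phi \+ dx psi; last exact: IH.
  apply/funext => z; have [? ?] := dphi z; have [? ?] := dpsi z.
  exact: deriveD.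
Qed.

Lemma CkM k phi psi : Ck k phi -> Ck k psi -> Ck k (phi \* psi).
Proof.
elim: k phi psi => [|k IH] phi psi.
  move=> [cphi _] [cpsi _]; split => //.
  by move=> z; apply: continuousM; [exact: cphi|exact: cpsi].
move=> Hphi Hpsi; have Kphi := CkS Hphi; have Kpsi := CkS Hpsi.
move: Hphi Hpsi => [cphi [dphi tphi xphi]] [cpsi [dpsi tpsi xpsi]]; split.
  by move=> z; apply: continuousM; [exact: cphi|exact: cpsi].
split.
- move=> z; have [p1 p2] := dphi z; have [q1 q2] := dpsi z.
  split; [exact: (derivableM p1 q1)|exact: (derivableM p2 q2)].
- have -> : dt (phi \* psi) = (phi \* dt psi) \+ (psi \* dt phi).
    apply/funext => z; have [p _] := dphi z; have [q _] := dpsi z.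
    exact: (deriveM p q).
  by apply: CkD; exact: IH.
- have -> : dx (phi \* psi) = (phi \* dx psi) \+ (psi \* dx phi).
    apply/funext => z; have [_ p] := dphi z; have [_ q] := dpsi z.
    exact: (deriveM p q).
  by apply: CkD; exact: IH.
Qed.

(** Each partial derivative is [(f' \o phi)] times that of [phi]; the induction runs over all [f] at
    once because [f'] inherits the hypothesis. *)
Lemma Ck_comp k (f : R -> R) phi :
  (forall l x, derivable (derive1n l f) x 1) -> Ck k phi -> Ck k (f \o phi).
Proof.
have cont (g : R -> R) psi : (forall x, derivable g x 1) -> continuous psi ->
    continuous (g \o psi).
  move=> dg cpsi z; apply: continuous_comp; first exact: cpsi.
  exact/differentiable_continuous/derivable1_diffP/dg.
elim: k f phi => [|k IH] f phi df Hphi.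
  by split => //; apply: cont (df 0) _; case: Hphi.
have Kphi := CkS Hphi.
have df' l x : derivable (derive1n l (derive1 f)) x 1.
  by rewrite -derive1Sn; exact: df.
move: Hphi => [cphi [dphi tphi xphi]]; split; first exact: cont (df 0) _.
have D v z := is_derive_comp_line (v := v) (df 0 (phi z)).
split.
- move=> z; have [/D[a1 _] /D[a2 _]] := dphi z.
  split; [exact: a1|exact: a2].
- have -> : dt (f \o phi) = (derive1 f \o phi) \* dt phi.
    by apply/funext => z; have [/D[_ ?] _] := dphi z.
  by apply: CkM => //; exact: IH.
- have -> : dx (f \o phi) = (derive1 f \o phi) \* dx phi.
    by apply/funext => z; have [_ /D[_ ?]] := dphi z.
  by apply: CkM => //; exact: IH.
Qed.

Lemma is_derive_additive (l : R * R -> R) z v :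
  (forall h, l (h *: v + z) = h * l v + l z) -> is_derive z v l (l v).
Proof.
move=> lE.
have key : h^-1 *: ((l \o shift z) (h *: v) - l z) @[h --> (0 : R)^'] --> l v.
  apply: cvg_near_cst; near=> h.
  have h0 : h != 0 by near: h; exact: nbhs_dnbhs_neq.
  by rewrite /= lE addrK /GRing.scale/= mulKf.
by split; [apply/cvg_ex; exists (l v)|exact: cvg_lim key].
Unshelve. all: by end_near. Qed.

Lemma is_derive_fst z v : is_derive z v fst v.1.
Proof. exact: is_derive_additive. Qed.

Lemma is_derive_snd z v : is_derive z v snd v.2.
Proof. exact: is_derive_additive. Qed.

Lemma Ck_fst k : Ck k (fst : R * R -> R).
Proof.
case: k => [|k]; first by split=> //; move=> z; exact: cvg_fst.
split; first by move=> z; exact: cvg_fst.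
have D v : (fun z => 'D_v fst z) = cst v.1.
  by apply/funext => z; have [] := is_derive_fst z v.
split.
- by move=> z; split; [have [] := is_derive_fst z (1, 0)|have [] := is_derive_fst z (0, 1)].
- by rewrite /dt D; exact: Ck_cst.
- by rewrite /dx D; exact: Ck_cst.
Qed.

Lemma Ck_snd k : Ck k (snd : R * R -> R).
Proof.
case: k => [|k]; first by split=> //; move=> z; exact: cvg_snd.
split; first by move=> z; exact: cvg_snd.
have D v : (fun z => 'D_v snd z) = cst v.2.
  by apply/funext => z; have [] := is_derive_snd z v.
split.
- by move=> z; split; [have [] := is_derive_snd z (1, 0)|have [] := is_derive_snd z (0, 1)].
- by rewrite /dt D; exact: Ck_cst.
- by rewrite /dx D; exact: Ck_cst.
Qed.

Lemma smooth_expR (k : nat) (x : R) : derivable (derive1n k expR) x 1.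
Proof.
have dexp : derive1 expR = expR :> (R -> R).
  by apply/funext => y; rewrite derive1E; have [] := is_derive_expR y.
have -> : derive1n k expR = expR :> (R -> R).
  by elim: k => // k IH; rewrite derive1nS IH.
by have [] := is_derive_expR x.
Qed.

End Smooth.

(** * Lower integrals and couplings *)

Section IntegralOrder.
Context d (T : measurableType d) (R : realType).
Variable mu : {measure set T -> \bar R}.

(* The Lebesgue integral of the library is a lower integral, hence monotone
   without any measurability assumption. *)
Lemma le_integral_nomeas (D : set T) (f g : T -> \bar R) :
  (forall x, D x -> (f x <= g x)%E) ->
  (\int[mu]_(x in D) f x <= \int[mu]_(x in D) g x)%E.
Proof.
move=> fg.
have fgD x : ((f \_ D) x <= (g \_ D) x)%E.
  by rewrite /patch; case: ifPn => // /set_mem; exact: fg.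
rewrite /integral; apply: leeB; apply: le_ereal_sup => _ [h hle <-];
  exists h => // x; apply: (le_trans (hle x)).
- by rewrite !funeposE ge_max le_max fgD/= le_max lexx orbT.
- by rewrite !funenegE ge_max le_max leeN2 fgD/= le_max lexx orbT.
Qed.

(** [fine] sends infinite values to 0 and is monotone only between finite ones; the integrable
    bounds on both sides force the middle integral to be finite. *)
Lemma le_Rintegral_sandwich (D : set T) (f g k : T -> R) : measurable D ->
  mu.-integrable D (EFin \o f) -> mu.-integrable D (EFin \o k) ->
  (forall x, D x -> f x <= g x) -> (forall x, D x -> g x <= k x) ->
  \int[mu]_(x in D) f x <= \int[mu]_(x in D) g x <= \int[mu]_(x in D) k x.
Proof.
move=> mD fi ki fg gk.
have fg' : (\int[mu]_(x in D) (f x)%:E <= \int[mu]_(x in D) (g x)%:E)%E.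
  by apply: le_integral_nomeas => x Dx; rewrite lee_fin fg.
have gk' : (\int[mu]_(x in D) (g x)%:E <= \int[mu]_(x in D) (k x)%:E)%E.
  by apply: le_integral_nomeas => x Dx; rewrite lee_fin gk.
have fF := integrable_fin_num mD fi; have kF := integrable_fin_num mD ki.
have gF : (\int[mu]_(x in D) (g x)%:E)%E \is a fin_num.
  rewrite fin_numElt (lt_le_trans _ fg') ?(le_lt_trans gk')//.
  - by move: kF; rewrite fin_numElt => /andP[].
  - by move: fF; rewrite fin_numElt => /andP[].
by rewrite /Rintegral !fine_le.
Qed.

End IntegralOrder.

Section FiniteMass.
Context {R : realType}.
Implicit Types (mu nu : borelMeasure R) (q : R).

Lemma integrable_dominated mu (f g : R -> R) :
  measurable_fun setT f -> mu.-integrable setT (EFin \o g) ->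
  (forall x, `|f x| <= g x) -> mu.-integrable setT (EFin \o f).
Proof.
move=> mf gi fg; apply: le_integrable gi => //.
  exact/measurable_EFinP.
by move=> x _ /=; rewrite lee_fin (le_trans (fg x))// ler_norm.
Qed.

Lemma integrable_cst_mass mu q (c : R) : mu setT = q%:E ->
  mu.-integrable setT (EFin \o cst c).
Proof.
move=> muq; apply/integrableP; split; first exact/measurable_EFinP.
rewrite (eq_integral (cst (`|c|%:E)%E))//.
by rewrite integral_cst//= muq -EFinM ltry.
Qed.

Lemma integrable_sqr mu :
  (\int[mu]_x (`|x| ^+ 2)%:E < +oo)%E ->
  mu.-integrable setT (EFin \o (fun x : R => `|x| ^+ 2)).
Proof.
move=> m2; apply/integrableP; split.
  by apply/measurable_EFinP/measurable_funX; exact: normr_measurable.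
apply: le_lt_trans m2; apply: le_integral_nomeas => x _.
by rewrite /= ger0_norm// exprn_ge0.
Qed.

Lemma integrable_normr mu q : mu setT = q%:E ->
  (\int[mu]_x (`|x| ^+ 2)%:E < +oo)%E ->
  mu.-integrable setT (EFin \o (fun x : R => `|x|)).
Proof.
move=> muq m2.
apply: (@integrable_dominated mu _ (fun x : R => 1 + `|x| ^+ 2)) => //.
- exact: (integrableD measurableT (integrable_cst_mass 1 muq) (integrable_sqr m2)).
- by move=> x; rewrite normr_id; nra.
Qed.

End FiniteMass.

(* Lets a measure of finite total mass be used where the library asks for a
   [{finite_measure ...}]. *)
Definition finite_copy d (T : measurableType d) (R : realType)
  (mu : {measure set T -> \bar R}) of fin_num_fun mu : set T -> \bar R := mu.

HB.instance Definition _ d (T : measurableType d) (R : realType)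
  (mu : {measure set T -> \bar R}) (fmu : fin_num_fun mu) :=
  Measure.copy (finite_copy fmu) mu.

HB.instance Definition _ d (T : measurableType d) (R : realType)
  (mu : {measure set T -> \bar R}) (fmu : fin_num_fun mu) :=
  Measure_isFinite.Build _ _ _ (finite_copy fmu) fmu.

(** * Transport cost: duality and finiteness *)

Section Couplings.
Context {R : realType}.
Implicit Types (mu nu : borelMeasure R) (f a b : R -> R).
Notation RR := (measurableTypeR R * measurableTypeR R)%type.

Lemma integral_marginal (gamma : {finite_measure set RR -> \bar R})
    (pi : RR -> measurableTypeR R) mu f : measurable_fun setT pi ->
  (forall A, measurable A -> pushforward gamma pi A = mu A) ->
  mu.-integrable setT (EFin \o f) ->
  gamma.-integrable setT (EFin \o (f \o pi)) /\
  \int[gamma]_z f (pi z) = \int[mu]_x f x.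
Proof.
move=> mpi gpi fi.
have mf : measurable_fun setT f by apply/measurable_EFinP; exact: measurable_int fi.
pose mpi' : {mfun RR >-> measurableTypeR R} :=
  HB.pack pi (isMeasurableFun.Build _ _ _ _ pi mpi).
have muE F : (\int[mu]_x F x = \int[pushforward gamma mpi']_x F x)%E.
  by apply: eq_measure_integral => A mA _; rewrite -gpi.
have fpi : gamma.-integrable setT (EFin \o (f \o pi)).
  apply/integrableP; split; first exact/measurable_EFinP/measurableT_comp.
  have /integrableP[_] := fi; apply: le_lt_trans.
  rewrite muE.
  rewrite ge0_integral_pushforward//.
  by apply/measurableT_comp => //; exact/measurable_EFinP.
split => //; rewrite /Rintegral; congr fine.
rewrite muE.
by rewrite integral_pushforward//; exact/measurable_EFinP.
Qed.

Lemma transport_cost_ge0 mu nu : (0 <= transport_cost mu nu)%E.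
Proof.
apply: le_ereal_inf_tmp => _ [gamma _ <-].
by apply: integral_ge0 => z _; rewrite lee_fin exprn_ge0.
Qed.

(** Easy half of Kantorovich duality: the pointwise inequality is integrated against an arbitrary
    coupling, then the infimum is taken. It is the only way in which the transport distance gives
    information on integrals. *)
Lemma transport_cost_dual mu nu a b (L : R) : 0 < L ->
  mu.-integrable setT (EFin \o a) -> nu.-integrable setT (EFin \o b) ->
  (forall x y, a x <= b y + L * `|x - y| ^+ 2) ->
  (transport_cost mu nu < +oo)%E ->
  \int[mu]_x a x <= \int[nu]_y b y + L * fine (transport_cost mu nu).
Proof.
move=> L0 ai bi ab cfin.
rewrite -lerBlDl mulrC -ler_pdivrMr// -lee_fin fineK; last first.
  by rewrite ge0_fin_numE// transport_cost_ge0.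
apply: le_ereal_inf_tmp => _ [gamma gmn <-].
have [a1 a2] := integral_marginal (pi := fst) measurable_fst (fun A mA => (gmn A mA).1) ai.
have [b1 b2] := integral_marginal (pi := snd) measurable_snd (fun A mA => (gmn A mA).2) bi.
rewrite -a2 -b2 -RintegralB// -RintegralZr//; last first.
  exact: (integrableB measurableT a1 b1).
have hi : gamma.-integrable setT (EFin \o (fun z : RR => (a z.1 - b z.2) / L)).
  exact: (integrableZr measurableT L^-1 (integrableB measurableT a1 b1)).
rewrite /Rintegral fineK; last exact: integrable_fin_num.
apply: le_integral_nomeas => z _.
by rewrite lee_fin ler_pdivrMr// lerBlDl mulrC ab.
Qed.

(** The normalised product measure is a coupling, and [|x - y|^2 <= 2 (|x|^2 + |y|^2)]. Finiteness
    matters because [fine] would turn an infinite cost into 0. *)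
Lemma transport_cost_lty mu nu q : 0 < q ->
  mu setT = q%:E -> nu setT = q%:E ->
  (\int[mu]_x (`|x| ^+ 2)%:E < +oo)%E -> (\int[nu]_x (`|x| ^+ 2)%:E < +oo)%E ->
  (transport_cost mu nu < +oo)%E.
Proof.
move=> q0 muq nuq mu2 nu2.
have fmu : fin_num_fun nu.
  move=> A mA; rewrite ge0_fin_numE// (@le_lt_trans _ _ (nu setT))//.
    by apply: le_measure; rewrite ?inE.
  by rewrite nuq ltry.
pose nu' : {finite_measure set (measurableTypeR R) -> \bar R} :=
  finite_copy fmu.
have qi0 : 0 <= q^-1 by rewrite invr_ge0 ltW.
(* Each marginal of the product carries an extra factor [q], the mass of the other measure; [q^-1]
   removes it. *)
pose g : {measure set RR -> \bar R} := mscale (NngNum qi0) (mu \x nu')%E.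
have gX A B : measurable A -> measurable B -> g (A `*` B) = (q^-1%:E * (mu A * nu B))%E.
  by move=> mA mB; rewrite /g/= /mscale/= product_measure1E.
have gT : g setT = q%:E.
  by rewrite -setXTT gX// muq nuq -!EFinM mulKf// gt_eqF.
have fg : fin_num_fun g.
  move=> A mA; rewrite ge0_fin_numE// (@le_lt_trans _ _ (g setT))//.
    by apply: le_measure; rewrite ?inE.
  by rewrite gT ltry.
pose gamma : {finite_measure set RR -> \bar R} :=
  finite_copy fg.
have gmn : couplings mu nu gamma.
  move=> A mA; split.
    rewrite /pushforward (_ : fst @^-1` A = A `*` setT); last by rewrite setXT.
    rewrite [LHS]gX// nuq muleCA -EFinM mulVf ?gt_eqF// mule1//.
  rewrite /pushforward (_ : snd @^-1` A = setT `*` A); last by rewrite setTX.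
  by rewrite [LHS]gX// muq muleA -EFinM mulVf ?gt_eqF// mul1e.
have [a1 _] := integral_marginal (pi := fst) measurable_fst
  (fun A mA => (gmn A mA).1) (integrable_sqr mu2).
have [b1 _] := integral_marginal (pi := snd) measurable_snd
  (fun A mA => (gmn A mA).2) (integrable_sqr nu2).
have si := integrableZl measurableT 2 (integrableD measurableT a1 b1).
apply: (@le_lt_trans _ _ (\int[gamma]_z (2%:E * ((`|z.1| ^+ 2)%:E + (`|z.2| ^+ 2)%:E)))%E).
  apply: (@le_trans _ _ (\int[gamma]_z (`|z.1 - z.2| ^+ 2)%:E)%E).
    by apply: ereal_inf_lbound; exists gamma.
  apply: le_integral_nomeas => z _; rewrite -EFinD -EFinM lee_fin.
  have := ler_normB z.1 z.2; have := normr_ge0 (z.1 - z.2).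
  have := sqr_ge0 (`|z.1| - `|z.2|).
  nra.
have := integrable_fin_num measurableT si.
by rewrite fin_numElt => /andP[].
Qed.

End Couplings.

(** * Bounds on the potential and on absolutely continuous curves *)

Section Growth.
Context {R : realType}.

(** The point [z + h] is the convex combination of [z + r] and [z] with weight [h / r]. *)
Lemma convexS_diff_quotient (u : R -> R) (z h r : R) : 0 < h <= r ->
  convex_function (E := R^o) setT u ->
  (u (z + h) - u z) / h <= (u (z + r) - u z) / r.
Proof.
move=> /andP[h0 hr] cu; have r0 := lt_le_trans h0 hr.
have t0 : 0 <= h / r by rewrite divr_ge0 ?ltW.
have t1 : h / r <= 1 by rewrite ler_pdivrMr// mul1r.
have H : u (h / r * (z + r) + (1 - h / r) * z) <=
    h / r * u (z + r) + (1 - h / r) * u z.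
  by apply: (cu (Itv01 t0 t1) (z + r) z); rewrite inE.
have zh : h / r * (z + r) + (1 - h / r) * z = z + h by field; rewrite gt_eqF.
rewrite zh in H.
rewrite ler_pdivrMr// mulrAC lerBlDr (le_trans H)//.
by rewrite le_eqVlt; apply/orP; left; apply/eqP; field; rewrite gt_eqF.
Qed.

Lemma derive1_even (w : R -> R) z : (forall y, w (- y) = w y) ->
  derivable w z 1 -> derivable w (- z) 1 -> derive1 w (- z) = - derive1 w z.
Proof.
move=> we dwz dw.
have := @derive1_comp R (-%R) w z (@derivable_opp R z 1) dw.
rewrite (_ : w \o -%R = w); last by apply/funext => y; rewrite /= we.
have -> : derive1 (-%R : R -> R) z = -1.
  rewrite derive1E; have := @deriveN _ _ _ id z 1 (@derivable_id _ _ z 1).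
  by rewrite derive_id => <-.
by rewrite mulrN1 => ->; rewrite opprK.
Qed.

(** The derivative of a convex function is below its forward difference quotients, and these see
    only values of [w]. *)
Lemma derive1_le_quadratic (w : R -> R) (k c z : R) :
  (forall y, derivable w y 1) ->
  (forall y, `|w y| <= c * (1 + `|y| ^+ 2)) ->
  convex_function (E := R^o) setT (fun y => w y - 2^-1 * k * `|y| ^+ 2) ->
  derive1 w z <= (5 * c + 5 * `|k|) * (1 + `|z|).
Proof.
move=> dw wc cu; set u := (fun y => _) in cu.
have uE y : u y = w y - 2^-1 * k * y ^+ 2 by rewrite /u real_normK ?num_real.
have c0 : 0 <= c by have := wc 0; rewrite normr0 expr0n addr0 mulr1; apply: le_trans.
have [z0 k0] := (normr_ge0 z, normr_ge0 k).
have kle y : `|2^-1 * k * y ^+ 2| = 2^-1 * `|k| * `|y| ^+ 2.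
  by rewrite !normrM (ger0_norm (_ : 0 <= 2^-1))// normrX.
(* A step comparable to [1 + |z|] makes the quotient of a quadratically growing function linear in
   [|z|]; a fixed step would leave it quadratic. *)
pose r := 1 + `|z|.
have r0 : 0 < r by rewrite /r; lra.
have ub : (u (z + r) - u z) / r <= 5 * (c + 2^-1 * `|k|) * r.
  rewrite ler_pdivrMr// !uE.
  have H1 := le_trans (ler_norm _) (wc (z + r)).
  have := wc z; rewrite ler_norml => /andP[H2 _].
  have := ler_norm (2^-1 * k * z ^+ 2); rewrite kle => H3.
  have := ler_norm (- (2^-1 * k * (z + r) ^+ 2)); rewrite normrN kle => H4.
  have H5 : `|z + r| ^+ 2 <= (1 + 2 * `|z|) ^+ 2.
    rewrite ler_sqr ?nnegrE ?addr_ge0 ?mulr_ge0//.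
    by rewrite (le_trans (ler_normD _ _))// (ger0_norm (ltW r0)) /r; lra.
  have H6 : c * `|z + r| ^+ 2 <= c * (1 + 2 * `|z|) ^+ 2 by rewrite ler_wpM2l.
  have H7 : `|k| * `|z + r| ^+ 2 <= `|k| * (1 + 2 * `|z|) ^+ 2 by rewrite ler_wpM2l.
  have H8 : 0 <= c * `|z| by rewrite mulr_ge0.
  have H9 : 0 <= `|k| * `|z| by rewrite mulr_ge0.
  rewrite /r in H1 H4 H6 H7 *; lra.
have bnd h : 0 < h -> h < r -> (w (h + z) - w z) / h <= (5 * c + 5 * `|k|) * r.
  move=> h0 hr.
  have H := @convexS_diff_quotient u z h r; rewrite h0 (ltW hr) in H.
  have {}H := le_trans (H isT cu) ub.
  (* Returning from [u] to [w] restores the difference quotient of the removed parabola. *)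
  have -> : (w (h + z) - w z) / h = (u (z + h) - u z) / h + k * z + 2^-1 * k * h.
    by rewrite !uE (addrC h z); field; rewrite gt_eqF.
  have K1 : k * z <= `|k| * `|z| by rewrite -normrM ler_norm.
  have K2 : k * h <= `|k| * r.
    by apply: le_trans (ler_norm _) _; rewrite normrM ler_wpM2l// (gtr0_norm h0) ltW.
  rewrite /r in H K2 *; nra.
have cl : h^-1 *: ((w \o shift z) (h *: 1) - w z) @[h --> (0 : R)^'+] --> derive1 w z.
  apply: cvg_dnbhs_at_right; rewrite derive1E; exact: dw.
rewrite -(cvg_lim _ cl)//; apply: limr_le.
  by apply/cvg_ex; exists (derive1 w z).
near=> h.
rewrite /= /GRing.scale/= mulr1 mulrC; apply: bnd.
  by near: h; exact: nbhs_right_gt.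
by near: h; exact: nbhs_right_lt.
Unshelve. all: by end_near. Qed.

Lemma admissible_derive1_bound n (W : R -> 'M[R]_n) : admissible W ->
  exists2 C : R, 0 <= C &
    forall i j z, `|derive1 (fun y => W y i j) z| <= C * (1 + `|z|).
Proof.
move=> [_ C1 even [Wbar growth] [kappa [_ conv]]].
pose c i j := 5 * Wbar i j + 5 * `|kappa i j|.
have c0 i j : 0 <= c i j.
  have := growth 0 i j; rewrite normr0 expr0n addr0 mulr1 => H.
  by rewrite addr_ge0// mulr_ge0// (le_trans _ H).
(* Summing over all pairs gives one constant uniform in [i] and [j]. *)
exists (\sum_i \sum_j c i j); first by do 2 (apply: sumr_ge0 => ? _).
move=> i j z.
have cle : c i j <= \sum_i \sum_j c i j.
  rewrite (bigD1 i)//= (bigD1 j)//= -addrA lerDl addr_ge0//.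
    exact: sumr_ge0.
  by apply: sumr_ge0 => ? _; exact: sumr_ge0.
apply: (@le_trans _ _ (c i j * (1 + `|z|))); last first.
  by rewrite ler_wpM2r// addr_ge0.
have [dw _] := C1 i j.
have up y := @derive1_le_quadratic _ (kappa i j) _ y dw (fun y => growth y i j) (conv i j).
(* W_ij' is odd, so the lower bound is the upper bound at the opposite point. *)
rewrite ler_norml up andbT lerNl.
rewrite -derive1_even//; last by move=> y; rewrite -even.
by rewrite (le_trans (up _))// normrN.
Qed.

End Growth.

(** * Supports and null sets *)

Section Support.
Context {R : realType}.
Implicit Types mu : borelMeasure R.

(** A point off the support has a null neighbourhood, hence lies in a null interval with rational
    endpoints, and there are countably many of these. *)
Lemma negligible_setC_supp mu : mu.-negligible (~` supp mu).
Proof.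
(* [N k] is the rational interval coded by [k] if that interval is null, and empty otherwise. *)
pose N (k : nat) : set R := if unpickle k is Some (q1, q2) then
  if (mu `]ratr q1, ratr q2[%classic == 0)%E then `]ratr q1 : R, ratr q2[%classic else set0
  else set0.
have : mu.-negligible (\bigcup_k N k).
  apply: negligible_bigcup => k; rewrite /N.
  case: (unpickle k) => [[q1 q2]|]; last exact: negligible_set0.
  case: ifPn => [/eqP H|_]; last exact: negligible_set0.
  by exists `]ratr q1 : R, ratr q2[%classic; split.
apply: negligibleS => x /= /existsNP[U /not_implyP[[oU Ux] /negP]].
rewrite -leNgt => muU.
have [e /= e0 eU] : nbhs_ball x U by apply/nbhs_ballP; exact: open_nbhs_nbhs.
have [q1] := @rat_in_itvoo R (x - e) x ltac:(by rewrite ltrBlDr ltrDl).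
rewrite in_itv/= => /andP[q1e q1x].
have [q2] := @rat_in_itvoo R x (x + e) ltac:(by rewrite ltrDl).
rewrite in_itv/= => /andP[xq2 q2e].
have [k kE] : exists k, unpickle k = Some (q1, q2).
  by exists (pickle (q1, q2)); exact: pickleK.
exists k; first exact: I.
rewrite /N kE.
have sub : `]ratr q1 : R, ratr q2[%classic `<=` U.
  move=> y /=; rewrite in_itv/= => /andP[y1 y2]; apply: eU.
  by rewrite /ball/= ltr_norml; apply/andP; split; lra.
suff -> : (mu `]ratr q1, ratr q2[%classic == 0)%E by rewrite /= in_itv/= q1x xq2.
rewrite eq_le measure_ge0 andbT (le_trans _ muU)//.
by apply: le_measure => //; rewrite inE//; exact: open_measurable.
Qed.

Lemma measurable_norm_gt (r : R) : measurable [set x : measurableTypeR R | r < `|x|].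
Proof.
rewrite [X in measurable X](_ : _ = (fun x : R => `|x|) @^-1` `]r, +oo[); last first.
  by apply/seteqP; split => x /=; rewrite in_itv/= andbT.
by rewrite -[X in measurable X]setTI; exact: normr_measurable.
Qed.

(** The initial supports enter the argument only in this form. *)
Lemma supp_bounded_null mu : compact (supp mu) ->
  exists2 M : R, 0 <= M & mu [set x | M < `|x|] = 0%E.
Proof.
move=> /compact_bounded[M0 [_ HM]].
pose M := Num.max 0 (M0 + 1).
exists M; first by rewrite le_max lexx.
apply/(measure_negligible (measurable_norm_gt M)).
apply: negligibleS (negligible_setC_supp mu) => x /= Mx sx.
have : `|x| <= M by apply: HM sx; rewrite /M lt_max; apply/orP; right; lra.
by rewrite leNgt Mx.
Qed.

End Support.

(** * Moment bound and uniform continuity in time *)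

Section AbsoluteContinuity.
Context {R : realType} {n : nat}.
Variables (m p : 'I_n -> R) (E : R).
Hypotheses (hm : forall i, 0 < m i) (hp : forall i, 0 < p i).
Implicit Types (mu nu : 'I_n -> borelMeasure R).

Lemma cost_le_WP mu nu j : fine (transport_cost (mu j) (nu j)) <= m j * WP m mu nu ^+ 2.
Proof.
have F0 i : 0 <= (m i)^-1 * fine (transport_cost (mu i) (nu i)).
  apply: mulr_ge0; first by rewrite invr_ge0 ltW.
  exact/fine_ge0/transport_cost_ge0.
rewrite /WP sqr_sqrtr; last by apply: sumr_ge0.
rewrite -ler_pdivrMl// (bigD1 j)//= lerDl.
by apply: sumr_ge0.
Qed.

Lemma phase_space_cost_lty mu nu j :
  phase_space m p E mu -> phase_space m p E nu ->
  (transport_cost (mu j) (nu j) < +oo)%E.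
Proof.
move=> [mu1 mu2 _] [nu1 nu2 _].
exact: (@transport_cost_lty _ _ _ (p j)).
Qed.

Variables (mu : R -> 'I_n -> borelMeasure R) (T : R).
Hypotheses (hT : 0 < T) (hAC : AC2_loc (phase_space m p E) (WP m) mu).

(** [Q] is the integral of the squared speed over [[0, T]]. The parameter [e] stays free: [e = 1]
    bounds the distance to the initial datum, and a small [e] followed by a small [t - s] gives
    uniform continuity. *)
Lemma WP_modulus : exists2 Q : R, 0 <= Q & forall e s t : R, 0 < e ->
  0 <= s -> s <= t -> t <= T -> WP m (mu s) (mu t) <= e * Q + (t - s) / e.
Proof.
have [_ /(_ T hT)[phi [mphi phi2] H]] := hAC.
have phi2i : lebesgue_measure.-integrable `[0, T] (EFin \o (fun r => `|phi r| ^+ 2)).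
  apply/integrableP; split.
    apply/measurable_EFinP/measurable_funX.
    exact: (@measurableT_comp _ _ _ _ _ _ (fun x : R => `|x|) _ phi (@normr_measurable R setT) mphi).
  by apply: le_lt_trans phi2; apply: le_integral_nomeas => x _; rewrite /= ger0_norm// exprn_ge0.
exists (\int[lebesgue_measure]_(r in `[0, T]) `|phi r| ^+ 2).
  by apply: Rintegral_ge0 => x _; rewrite exprn_ge0.
move=> e s t e0 s0 st tT; apply: (le_trans (H s t s0 st tT)).
have sub : `[s, t] `<=` `[0, T].
  move=> r /=; rewrite !in_itv/= => /andP[sr rt].
  by rewrite (le_trans s0)//= (le_trans rt).
have i2 : lebesgue_measure.-integrable `[s, t] (EFin \o (fun r => `|phi r| ^+ 2)).
  by apply: integrableS phi2i.
have lfin : (lebesgue_measure `[s, t]%classic < +oo :> \bar R)%E.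
  by rewrite lebesgue_measure_itv/=; case: ifP => _; rewrite ?ltry// -EFinB ltry.
have ic : lebesgue_measure.-integrable `[s, t] (EFin \o cst e^-1).
  apply/integrableP; split; first exact/measurable_EFinP.
  rewrite (eq_integral (cst (`|e^-1|%:E)%E))//.
  by rewrite integral_cst// lte_mul_pinfty.
have ie : lebesgue_measure.-integrable `[s, t] (EFin \o (fun r => e * `|phi r| ^+ 2)).
  exact: (integrableZl _ e i2).
have ik : lebesgue_measure.-integrable `[s, t] (EFin \o (fun r => e * `|phi r| ^+ 2 + e^-1)).
  exact: (integrableD _ ie ic).
(* AM-GM replaces Cauchy-Schwarz, so that no L^2 theory is needed. *)
have key r : `|phi r| <= e * `|phi r| ^+ 2 + e^-1.
  have ee : e * e^-1 = 1 by rewrite divff// gt_eqF.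
  have ei0 : 0 < e^-1 by rewrite invr_gt0.
  have : 0 <= e^-1 * (e * `|phi r| - 2^-1) ^+ 2 by rewrite mulr_ge0 ?sqr_ge0// ltW.
  have -> : e^-1 * (e * `|phi r| - 2^-1) ^+ 2 = e * `|phi r| ^+ 2 - `|phi r| + e^-1 / 4.
    by field; rewrite gt_eqF.
  lra.
have /andP[_ le1] := @le_Rintegral_sandwich _ _ _ lebesgue_measure _ _ phi _ (measurable_itv `[s, t])
  (integrableN ik) ik (fun x _ => lerNnormlW (key x)) (fun x _ => le_trans (ler_norm _) (key x)).
apply: (le_trans le1).
rewrite RintegralD// RintegralZl// Rintegral_cst//.
apply: lerD.
  apply: ler_wpM2l; first exact: ltW.
  rewrite /Rintegral; apply: fine_le.
  - by apply: integrable_fin_num; [exact: measurable_itv|exact: i2].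
  - by apply: integrable_fin_num; [exact: measurable_itv|exact: phi2i].
  - by apply: ge0_subset_integral => //; case/integrableP: phi2i.
rewrite [leRHS]mulrC; apply: ler_wpM2l; first by rewrite invr_ge0 ltW.
suff H1 : fine (lebesgue_measure (`[s, t]%classic : set R)) <= t - s by exact: H1.
rewrite lebesgue_measure_itv/= lte_fin; case: ltP => //= _.
by rewrite subr_ge0.
Qed.

Lemma first_moment_bounded : exists2 L : R, 0 <= L & forall t j, 0 <= t <= T ->
  \int[mu t j]_x `|x| <= p j * L.
Proof.
have [Q Q0 HQ] := WP_modulus.
have [ph _] := hAC.
(* The three terms integrate [|y| <= |x| + 1 + |x - y|^2]; the last uses that the distance to the
   initial datum is at most [Q + T]. *)
pose b j := \int[mu 0 j]_x `|x| + p j + m j * (Q + T) ^+ 2.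
have b0 j : 0 <= b j.
  apply: addr_ge0; last by rewrite mulr_ge0 ?sqr_ge0// ltW.
  apply: addr_ge0; last exact: ltW.
  by apply: Rintegral_ge0 => x _.
exists (\sum_j (p j)^-1 * b j).
  by apply: sumr_ge0 => j _; rewrite mulr_ge0// invr_ge0 ltW.
move=> t j /andP[t0 tT].
apply: (@le_trans _ _ (b j)); last first.
  rewrite -ler_pdivrMl// (bigD1 j)//= lerDl.
  by apply: sumr_ge0 => i _; rewrite mulr_ge0// invr_ge0 ltW.
have [P0 Pt] := (ph 0 (lexx _), ph t t0).
have i0 := integrable_normr (ps_mass P0 j) (ps_moment2 P0 j).
have it := integrable_normr (ps_mass Pt j) (ps_moment2 Pt j).
have ic := integrable_cst_mass 1 (ps_mass Pt j).
have ab (x y : R) : - `|x| <= (1 - `|y|) + 1 * `|x - y| ^+ 2.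
  have := ler_normD (y - x) x; rewrite subrK (distrC y) => H.
  have := sqr_ge0 (`|x - y| - 1); have := normr_ge0 (x - y); nra.
have := transport_cost_dual ltr01 (integrableN i0) (integrableB measurableT ic it) ab
  (phase_space_cost_lty j P0 Pt).
rewrite RintegralB// Rintegral_cst// (ps_mass Pt)/= mul1r.
have -> : \int[mu 0 j]_x - `|x| = - \int[mu 0 j]_x `|x|.
  under eq_Rintegral do rewrite -mulN1r.
  by rewrite RintegralZl// mulN1r.
have cb : fine (transport_cost (mu 0 j) (mu t j)) <= m j * (Q + T) ^+ 2.
  apply: (le_trans (cost_le_WP _ _ _)); apply: ler_wpM2l; first exact: ltW.
  rewrite ler_sqr ?nnegrE ?sqrtr_ge0 ?addr_ge0 ?(ltW hT)//.
  apply: (le_trans (HQ 1 0 t ltr01 (lexx _) t0 tT)).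
  by rewrite mul1r subr0 divr1 lerD2l.
rewrite /b; lra.
Qed.

(** The quadratic cost controls a Lipschitz increment through
    [C |x - y| <= a + (C^2 / a) |x - y|^2]: the constant costs [a * p j], the rest is transport
    cost, which is small for close times. *)
Lemma integral_lipschitz_modulus (g : R -> R) (C c : R) : 0 < C ->
  measurable_fun setT g -> (forall x, `|g x| <= c) ->
  (forall x y, `|g x - g y| <= C * `|x - y|) ->
  forall (j : 'I_n) e, 0 < e -> exists2 d : R, 0 < d & forall s t, 0 <= s -> s <= t -> t <= T ->
  t - s <= d -> `|\int[mu s j]_x g x - \int[mu t j]_x g x| <= e.
Proof.
move=> C0 mg gc gL j e e0.
have [Q Q0 HQ] := WP_modulus.
have [ph _] := hAC.
(* The error is split in halves: [a * p j = e / 2], and [w] solves [L * m j * w ^+ 2 = e / 2]. Then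
   [f] makes both terms of the modulus at most [w / 2]; [Q + 1] keeps its denominator positive. *)
pose a := e / (2 * p j).
have a0 : 0 < a by rewrite divr_gt0// mulr_gt0.
pose L := C ^+ 2 / a.
have L0 : 0 < L by rewrite divr_gt0// exprn_gt0.
have LE : L = C ^+ 2 / a by [].
clearbody L.
pose w := Num.sqrt (e / (2 * L * m j)).
have w0 : 0 < w by rewrite /w sqrtr_gt0 divr_gt0 ?mulr_gt0.
pose f := w / (2 * (Q + 1)).
have Q1 : 0 < Q + 1 by rewrite ltr_wpDl.
have f0 : 0 < f by rewrite divr_gt0// mulr_gt0.
exists (f * w / 2); first by rewrite divr_gt0// mulr_gt0.
move=> s t s0 st tT std.
have [Ps Pt] := (ph s s0, ph t (le_trans s0 st)).
have cb : L * fine (transport_cost (mu s j) (mu t j)) <= e / 2.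
  have H : WP m (mu s) (mu t) <= w.
    apply: (le_trans (HQ f s t f0 s0 st tT)).
    have H1 : f * Q <= w / 2.
      rewrite /f mulrAC -mulrA ler_pM2l// ler_pdivrMr ?mulr_gt0//.
      have -> : 2^-1 * (2 * (Q + 1)) = Q + 1 by field.
      by rewrite lerDl.
    have H2 : (t - s) / f <= w / 2.
      by rewrite ler_pdivrMr// mulrC mulrA.
    lra.
  have H2 : WP m (mu s) (mu t) ^+ 2 <= w ^+ 2.
    by rewrite ler_sqr ?nnegrE ?sqrtr_ge0// ltW.
  have w2 : w ^+ 2 = e / (2 * L * m j).
    by rewrite /w sqr_sqrtr//; apply/ltW; rewrite divr_gt0 ?mulr_gt0.
  rewrite w2 in H2.
  have H3 := le_trans (cost_le_WP (mu s) (mu t) j) (ler_wpM2l (ltW (hm j)) H2).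
  apply: (le_trans (ler_wpM2l (ltW L0) H3)).
  have -> // : L * (m j * (e / (2 * L * m j))) = e / 2.
  by field; rewrite !gt_eqF.
have gi q (nu : borelMeasure R) : nu setT = q%:E -> nu.-integrable setT (EFin \o g).
  move=> nuq; apply: (integrable_dominated mg (integrable_cst_mass c nuq)) => x.
  exact: gc.
have is_ := gi _ _ (ps_mass Ps j); have it := gi _ _ (ps_mass Pt j).
have ic := integrable_cst_mass a (ps_mass Pt j).
have amgm (x y : R) : C * `|x - y| <= a + L * `|x - y| ^+ 2.
  have : 0 <= a^-1 * (C * `|x - y| - a / 2) ^+ 2.
    by rewrite mulr_ge0 ?sqr_ge0// invr_ge0 ltW.
  have -> : a^-1 * (C * `|x - y| - a / 2) ^+ 2 = L * `|x - y| ^+ 2 - C * `|x - y| + a / 4.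
    by rewrite LE; field; rewrite gt_eqF.
  lra.
have ab1 x y : g x <= (g y + a) + L * `|x - y| ^+ 2.
  have := gL x y; have := amgm x y; rewrite ler_norml => ? /andP[_ ?]; lra.
have ab2 x y : - g x <= (a - g y) + L * `|x - y| ^+ 2.
  have := gL x y; have := amgm x y; rewrite ler_norml => ? /andP[? _]; lra.
have cl := phase_space_cost_lty j Ps Pt.
have := transport_cost_dual L0 is_ (integrableD measurableT it ic) ab1 cl.
have := transport_cost_dual L0 (integrableN is_) (integrableB measurableT ic it) ab2 cl.
rewrite RintegralB// RintegralD// Rintegral_cst// (ps_mass Pt)/=.
have -> : \int[mu s j]_x - g x = - \int[mu s j]_x g x.
  under eq_Rintegral do rewrite -mulN1r.
  by rewrite RintegralZl// mulN1r.
have -> : a * p j = e / 2 by rewrite /a; field; rewrite gt_eqF.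
by move=> h1 h2; rewrite ler_norml; apply/andP; split; lra.
Qed.

End AbsoluteContinuity.

(** * Test functions following a moving front *)

(* Smooth and nonincreasing, positive constant on (-oo, 0], zero on [1, +oo);
   not normalised: the plateau value [cutoff 0] is kept as a symbol. *)
Definition cutoff {R : realType} (y : R) : R := flat (flat 1 - flat y).

Definition cutoff' {R : realType} (y : R) : R :=
  - (derive1 flat (flat 1 - flat y) * derive1 flat y).

Section Cutoff.
Context {R : realType}.
Implicit Types (x y c a : R).

Lemma cutoff0_gt0 : 0 < cutoff 0 :> R.
Proof. by rewrite /cutoff [flat 0]flat_le0// subr0; do 2 apply: flat_gt0. Qed.

Lemma cutoff_le0 y : y <= 0 -> cutoff y = cutoff 0.
Proof. by move=> y0; rewrite /cutoff (flat_le0 y0) [flat 0]flat_le0. Qed.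

Lemma cutoff_ge1 y : 1 <= y -> cutoff y = 0.
Proof. by move=> y1; rewrite /cutoff flat_le0// subr_le0 flat_homo. Qed.

Lemma cutoff_ge0 y : 0 <= cutoff y.
Proof. exact: flat_ge0. Qed.

Lemma cutoff_le1 y : cutoff y <= 1.
Proof. exact: flat_le1. Qed.

Lemma cutoff_nincr x y : x <= y -> cutoff y <= cutoff x.
Proof. by move=> xy; apply: flat_homo; rewrite lerB// flat_homo. Qed.

Lemma cutoff_le_cutoff0 y : cutoff y <= cutoff 0.
Proof. by have [/cutoff_le0 ->//|/ltW] := leP y 0; exact: cutoff_nincr. Qed.

Lemma cutoff_lt y : 0 < y -> cutoff y < cutoff 0.
Proof.
move=> y0; apply: flat_lt; rewrite [flat 0]flat_le0// ?subr0; last exact: flat_gt0.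
by rewrite ltrBlDr ltrDl flat_gt0.
Qed.

Lemma is_derive_cutoff y : is_derive y 1 cutoff (cutoff' y).
Proof.
rewrite /cutoff' -mulrN.
apply: (@is_derive1_comp _ flat (fun y => flat 1 - flat y)).
  exact: is_derive_flat.
have := is_deriveB (is_derive_cst (flat (1 : R)) y 1) (is_derive_flat y).
by rewrite sub0r.
Qed.

Lemma cutoff'_le0 y : cutoff' y <= 0.
Proof. by rewrite oppr_le0 mulr_ge0 ?derive1_flat_ge0. Qed.

Lemma cutoff'_geN4 y : - 4 <= cutoff' y.
Proof.
rewrite lerN2 (_ : 4 = 2 * 2); last by rewrite -natrM.
by apply: ler_pM; rewrite ?derive1_flat_ge0 ?derive1_flat_le2.
Qed.

Lemma cutoff'_out y : ~~ (0 < y < 1) -> cutoff' y = 0.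
Proof.
rewrite negb_and -!leNgt => /orP[y0|y1]; rewrite /cutoff'.
  by rewrite (derive1_flat_le0 y0) mulr0 oppr0.
by rewrite derive1_flat_le0 ?mul0r ?oppr0// subr_le0 flat_homo.
Qed.

Lemma continuous_cutoff' : continuous (@cutoff' R).
Proof.
have c1 : continuous (derive1 flat : R -> R).
  move=> z; rewrite derive1_flat.
  exact/differentiable_continuous/derivable1_diffP/derivable_flatp.
have cd : continuous (fun y : R => flat 1 - flat y : R).
  by move=> y; apply: cvgB; [exact: cvg_cst|exact: continuous_flat].
have ca : continuous (fun y : R => derive1 flat (flat 1 - flat y) : R).
  by move=> y; exact: (continuous_comp (cd y) (c1 _)).
by move=> y; apply: cvgN; apply: cvgM; [exact: ca|exact: c1].
Qed.

Lemma is_derive_cutoff_sqr c a x :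
  is_derive x 1 (fun x => cutoff (c * x ^+ 2 - a)) (cutoff' (c * x ^+ 2 - a) * (c * (2 * x))).
Proof.
apply: (@is_derive1_comp _ cutoff (fun x => c * x ^+ 2 - a)).
  exact: is_derive_cutoff.
by apply: is_derive_eq; rewrite /GRing.scale/= ; ring.
Qed.

Lemma continuous_cutoff_sqr c a : continuous (fun x => cutoff (c * x ^+ 2 - a)).
Proof.
move=> x; apply/differentiable_continuous/derivable1_diffP.
by have [] := is_derive_cutoff_sqr c a x.
Qed.

(** By the mean value theorem, since the derivative vanishes unless [c z^2 < a + 1], where
    [c |z| <= c (1 + z^2) <= c + a + 1]. The 8 is the bound 4 on [cutoff'] times the 2 from
    differentiating the square. *)
Lemma cutoff_sqr_lipschitz c a x y : 0 < c -> 0 <= a ->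
  `|cutoff (c * x ^+ 2 - a) - cutoff (c * y ^+ 2 - a)| <=
  8 * (c + a + 1) * `|x - y|.
Proof.
move=> c0 a0; wlog yx : x y / y <= x.
  move=> H; have [|/ltW xy] := leP y x; first exact: H.
  by rewrite distrC [in leRHS]distrC H.
have cf : {within `[y, x], continuous (fun x => cutoff (c * x ^+ 2 - a))}.
  exact/continuous_subspaceT/continuous_cutoff_sqr.
have [z _ ->] := MVT_segment yx (fun z _ => is_derive_cutoff_sqr c a z) cf.
rewrite normrM ler_wpM2r//.
have [/andP[z0 z1]|/cutoff'_out ->] := boolP (0 < c * z ^+ 2 - a < 1); last first.
  by rewrite mul0r normr0 !mulr_ge0// !addr_ge0// ltW.
rewrite normrM (_ : 8 = 4 * 2); last by rewrite -natrM.
rewrite -mulrA; apply: ler_pM => //.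
  by rewrite ler0_norm ?cutoff'_le0// lerNl cutoff'_geN4.
rewrite mulrCA normrM [X in X * _]ger0_norm// ler_wpM2l// normrM (gtr0_norm c0).
have : `|z| <= 1 + z ^+ 2.
  by have := sqr_ge0 (`|z| - 1); rewrite -(real_normK (num_real z)); have := normr_ge0 z; nra.
by nra.
Qed.

Lemma Ck_cutoff k (phi : R * R -> R) : Ck k phi -> Ck k (cutoff \o phi).
Proof.
move=> kphi.
have := Ck_comp smooth_flat
  (CkD (Ck_cst k (flat 1)) (CkM (Ck_cst k (-1)) (Ck_comp smooth_flat kphi))).
congr (Ck k _); apply/funext => z.
by rewrite /cutoff/= mulN1r.
Qed.

End Cutoff.

(** Rises from 0 at [dl] to the plateau [cutoff 0] at [2 * dl]. The argument is spelled with sums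
    and products only, matching the combination of constants and projections used for smoothness. *)
Definition ramp {R : realType} (dl t : R) : R := cutoff (2 + - dl^-1 * t).

Definition ramp' {R : realType} (dl t : R) : R :=
  - (cutoff' (2 + - dl^-1 * t) * dl^-1).

Section Ramp.
Context {R : realType}.
Implicit Types (dl t : R).

Lemma is_derive_ramp dl t : is_derive t 1 (ramp dl) (ramp' dl t).
Proof.
rewrite /ramp' -mulrN.
apply: (@is_derive1_comp _ cutoff (fun t => 2 + - dl^-1 * t)).
  exact: is_derive_cutoff.
by apply: is_derive_eq; rewrite /GRing.scale/=; ring.
Qed.

Lemma ramp_le dl t : 0 < dl -> t <= dl -> ramp dl t = 0.
Proof.
move=> dl0 tdl; apply: cutoff_ge1.
have : t / dl <= 1 by rewrite ler_pdivrMr// mul1r.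
by rewrite mulrC mulNr; lra.
Qed.

Lemma ramp_ge dl t : 0 < dl -> 2 * dl <= t -> ramp dl t = cutoff 0.
Proof.
move=> dl0 tdl; apply: cutoff_le0.
have : 2 <= t / dl by rewrite ler_pdivlMr.
by rewrite mulrC mulNr; lra.
Qed.

Lemma ramp_ge0 dl t : 0 <= ramp dl t.
Proof. exact: cutoff_ge0. Qed.

Lemma ramp_le1 dl t : ramp dl t <= 1.
Proof. exact: cutoff_le1. Qed.

Lemma ramp'_ge0 dl t : 0 < dl -> 0 <= ramp' dl t.
Proof. by move=> dl0; rewrite oppr_ge0 mulr_le0_ge0 ?cutoff'_le0// invr_ge0 ltW. Qed.

Lemma ramp'_le dl t : 0 < dl -> ramp' dl t <= 4 / dl.
Proof.
move=> dl0; rewrite /ramp' -mulNr; apply: ler_wpM2r; first by rewrite invr_ge0 ltW.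
by rewrite lerNl cutoff'_geN4.
Qed.

Lemma ramp'_out dl t : 0 < dl -> ~~ (dl < t < 2 * dl) -> ramp' dl t = 0.
Proof.
move=> dl0 H; rewrite /ramp' cutoff'_out ?mul0r ?oppr0//; apply: contra H.
have -> : 2 + - dl^-1 * t = (2 * dl - t) / dl by field; rewrite gt_eqF.
by rewrite ltr_pdivlMr// mul0r ltr_pdivrMr// => /andP[? ?]; apply/andP; split; lra.
Qed.

Lemma continuous_ramp' dl : continuous (ramp' dl).
Proof.
move=> t; apply: cvgN; apply: cvgMl.
apply: (@continuous_comp _ _ _ (fun t : R => 2 + - dl^-1 * t) cutoff').
  by apply: cvgD; [exact: cvg_cst|apply: cvgMr; exact: cvg_id].
exact: continuous_cutoff'.
Qed.

End Ramp.

(** A time window inside [(0, t1)] times a cutoff that starts to fall on the curve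
    [|x| = sqrt a * exp (B t)]. *)
Definition barrier {R : realType} (dl t1 B a : R) (z : R * R) : R :=
  ramp dl z.1 * ramp dl (t1 + -1 * z.1) *
  cutoff (expR (- (2 * B) * z.1) * (z.2 * z.2) + - a).

Definition window {R : realType} (dl t1 t : R) : R :=
  ramp dl t * ramp dl (t1 - t).

Definition window' {R : realType} (dl t1 t : R) : R :=
  ramp' dl t * ramp dl (t1 - t) - ramp dl t * ramp' dl (t1 - t).

Definition decay {R : realType} (B t : R) : R := expR (- (2 * B) * t).

Section Barrier.
Context {R : realType}.
Variables (dl t1 B a : R).
Hypotheses (dl0 : 0 < dl) (B0 : 0 <= B) (a0 : 0 <= a).

Lemma Ck_barrier k : Ck k (barrier dl t1 B a).
Proof.
apply: CkM; first apply: CkM.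
- apply: (Ck_cutoff (phi := cst 2 \+ (cst (- dl^-1) \* fst))).
  exact: CkD (Ck_cst k _) (CkM (Ck_cst k _) (Ck_fst k)).
- apply: (Ck_cutoff (phi := cst 2 \+ (cst (- dl^-1) \* (cst t1 \+ (cst (-1) \* fst))))).
  exact: CkD (Ck_cst k _) (CkM (Ck_cst k _) (CkD (Ck_cst k _) (CkM (Ck_cst k _) (Ck_fst k)))).
- apply: (Ck_cutoff (phi := ((expR \o (cst (- (2 * B)) \* fst)) \* (snd \* snd)) \+ cst (- a))).
  apply: CkD (Ck_cst k _); apply: CkM (CkM (Ck_snd k) (Ck_snd k)).
  exact: (Ck_comp smooth_expR (CkM (Ck_cst k _) (Ck_fst k))).
Qed.

Lemma test_function_barrier : test_function (barrier dl t1 B a).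
Proof.
(* On the support [x^2 <= (a + 1) exp (2 B t)] with [t <= t1], and [|x| <= 1 + x^2]. *)
pose X := 1 + (a + 1) * expR (2 * B * t1).
pose box : set (R * R) := `[dl, t1 - dl]%classic `*` `[- X, X]%classic.
have cbox : compact box by apply: compact_setX; exact: segment_compact.
have sub : closure [set z | barrier dl t1 B a z != 0] `<=` box.
  have clbox : closed box by apply: compact_closed cbox; exact: norm_hausdorff.
  rewrite closureE; apply: smallest_sub => // -[t x] /=.
  rewrite /barrier/= => nz.
  have tdl : dl <= t.
    rewrite leNgt; apply: contra nz => /ltW/(ramp_le dl0) ->.
    by rewrite !mul0r.
  have tt1 : t <= t1 - dl.
    rewrite leNgt; apply: contra nz => H.
    by rewrite (@ramp_le _ _ (t1 + -1 * t)) ?mulr0 ?mul0r//; lra.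
  have Ex : expR (- (2 * B) * t) * (x * x) <= a + 1.
    rewrite leNgt; apply: contra nz => H.
    by rewrite cutoff_ge1 ?mulr0//; lra.
  have x2 : x ^+ 2 <= (a + 1) * expR (2 * B * t1).
    move: Ex; rewrite mulrC mulNr expRN ler_pdivrMr ?expR_gt0// -expr2 => Ex.
    apply: (le_trans Ex); rewrite ler_wpM2l ?addr_ge0// ler_expR.
    apply: ler_wpM2l; first by rewrite mulr_ge0.
    by rewrite (le_trans tt1)// lerBlDr lerDl ltW.
  split => /=; rewrite in_itv/=; first by rewrite tdl.
  rewrite -ler_norml /X.
  have := sqr_ge0 (`|x| - 1); have := normr_ge0 x.
  by move: x2; rewrite -(real_normK (num_real x)); nra.
split; first exact: Ck_barrier.
- apply: subclosed_compact sub => //; exact: closed_closure.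
- by move=> z /sub[]; rewrite /= in_itv/= => /andP[/(lt_le_trans dl0)].
Qed.

Lemma dtE (phi : R * R -> R) t x : dt phi (t, x) = 'D_1 (fun s : R => phi (s, x)) t.
Proof.
rewrite /dt /derive.
set F := (X in lim (X @ _)); set G := (X in _ = lim (X @ _)).
suff -> : F = G by [].
apply/funext => h; rewrite /F /G /=; congr (_ *: (phi _ - _)).
by apply/pair_equal_spec; split => //=; rewrite scaler0 add0r.
Qed.

Lemma dxE (phi : R * R -> R) t x : dx phi (t, x) = 'D_1 (fun y : R => phi (t, y)) x.
Proof.
rewrite /dx /derive.
set F := (X in lim (X @ _)); set G := (X in _ = lim (X @ _)).
suff -> : F = G by [].
apply/funext => h; rewrite /F /G /=; congr (_ *: (phi _ - _)).
by apply/pair_equal_spec; split => //=; rewrite scaler0 add0r.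
Qed.

Lemma dt_barrier t x : dt (barrier dl t1 B a) (t, x) =
  window' dl t1 t * cutoff (decay B t * x ^+ 2 - a) -
  window dl t1 t * cutoff' (decay B t * x ^+ 2 - a) * (2 * B) * (decay B t * x ^+ 2).
Proof.
rewrite dtE /barrier/=.
have d1 := is_derive_ramp dl t.
have d2 : is_derive t 1 (fun s => ramp dl (t1 + -1 * s)) (ramp' dl (t1 + -1 * t) * -1).
  apply: (@is_derive1_comp _ (ramp dl) (fun s => t1 + -1 * s)).
    exact: is_derive_ramp.
  by apply: is_derive_eq; rewrite /GRing.scale/=; ring.
have de : is_derive t 1 (fun s => expR (- (2 * B) * s)) (decay B t * - (2 * B)).
  apply: (@is_derive1_comp _ expR (fun s => - (2 * B) * s)).
  by apply: is_derive_eq; rewrite /GRing.scale/=; ring.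
have d3 : is_derive t 1 (fun s => cutoff (expR (- (2 * B) * s) * (x * x) + - a))
    (cutoff' (decay B t * (x * x) + - a) * (decay B t * - (2 * B) * (x * x))).
  apply: (@is_derive1_comp _ cutoff (fun s => expR (- (2 * B) * s) * (x * x) + - a)).
    exact: is_derive_cutoff.
  by apply: is_derive_eq; rewrite /GRing.scale/=; ring.
have [_ ->] := is_deriveM (is_deriveM d1 d2) d3.
have -> : (ramp dl * (fun s : R => ramp dl (t1 + -1 * s))) t =
    ramp dl t * ramp dl (t1 + -1 * t) by [].
rewrite /window /window' /GRing.scale/= -/(decay B t) mulN1r -expr2.
move: (ramp dl t) (ramp dl (t1 - t)) (ramp' dl t) (ramp' dl (t1 - t)) (decay B t).
move=> r r2 s s2 e.
move: (cutoff _) (cutoff' _) => c c'.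
by rewrite expr2; ring.
Qed.

Lemma dx_barrier t x : dx (barrier dl t1 B a) (t, x) =
  window dl t1 t * cutoff' (decay B t * x ^+ 2 - a) * decay B t * (2 * x).
Proof.
rewrite dxE /barrier/=.
have -> : (fun y => ramp dl t * ramp dl (t1 + -1 * t) *
      cutoff (expR (- (2 * B) * t) * (y * y) + - a)) =
    (fun y => window dl t1 t * cutoff (decay B t * y ^+ 2 - a)).
  by apply/funext => y; rewrite /window /decay mulN1r expr2.
have d3 := is_derive_cutoff_sqr (decay B t) a x.
have [_ ->] := is_deriveM (is_derive_cst (window dl t1 t) x 1) d3.
rewrite /GRing.scale/=.
by move: (window dl t1 t) (decay B t) (cutoff _) (cutoff' _) => w e c c'; ring.
Qed.

End Barrier.

(** The transport velocity of component [i] at [x] is [- m i * drift W mu i x]. *)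
Definition drift {R : realType} {n : nat} (W : R -> 'M[R]_n)
    (mu : 'I_n -> borelMeasure R) (i : 'I_n) (x : R) : R :=
  \sum_(j < n) \int[mu j]_y derive1 (fun z : R => W z i j) (x - y).

Section Drift.
Context {R : realType} {n : nat}.

Lemma drift_bound (W : R -> 'M[R]_n) (p r : 'I_n -> R) (C : R)
    (mu : 'I_n -> borelMeasure R) i x :
  0 <= C ->
  (forall i j z, `|derive1 (fun y => W y i j) z| <= C * (1 + `|z|)) ->
  (forall j, mu j setT = (p j)%:E) ->
  (forall j, (\int[mu j]_x (`|x| ^+ 2)%:E < +oo)%E) ->
  (forall j, \int[mu j]_y `|y| <= r j) ->
  `|drift W mu i x| <= \sum_j C * ((1 + `|x|) * p j + r j).
Proof.
move=> C0 HC mup mu2 mur; apply: (le_trans (ler_norm_sum _ _ _)).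
apply: ler_sum => j _.
have ic := integrable_cst_mass (C * (1 + `|x|)) (mup j).
have i1 := integrable_normr (mup j) (mu2 j).
have iC : (mu j).-integrable setT (EFin \o (fun y : R => C * `|y|)).
  exact: (integrableZl measurableT C i1).
have ik : (mu j).-integrable setT (EFin \o (fun y : R => C * (1 + `|x|) + C * `|y|)).
  exact: (integrableD measurableT ic iC).
have key (y : R) : `|derive1 (fun z => W z i j) (x - y)| <= C * (1 + `|x|) + C * `|y|.
  apply: (le_trans (HC i j _)); rewrite -mulrDr ler_wpM2l// -addrA lerD2l.
  exact: ler_normB.
have /andP[l1 l2] := le_Rintegral_sandwich measurableT (integrableN ik) ik
  (fun y _ => lerNnormlW (key y)) (fun y _ => le_trans (ler_norm _) (key y)).
have Nk : \int[mu j]_y - (C * (1 + `|x|) + C * `|y|) =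
    - \int[mu j]_y (C * (1 + `|x|) + C * `|y|).
  under eq_Rintegral do rewrite -mulN1r.
  by rewrite RintegralZl// mulN1r.
have kE : \int[mu j]_y (C * (1 + `|x|) + C * `|y|) <= C * ((1 + `|x|) * p j + r j).
  rewrite RintegralD// Rintegral_cst// (mup j)/= RintegralZl//.
  by rewrite -(mulrA C) -mulrDr ler_wpM2l// lerD2l.
rewrite ler_norml; apply/andP; split; last exact: le_trans l2 kE.
by apply: le_trans l1; rewrite [leRHS]Nk lerN2.
Qed.

(** The two transport terms combine to [w (- c') e * 2 (B x^2 + x m V)], which is nonnegative
    because the front outruns the drift wherever [c'] is nonzero. The upper bound uses
    [w (- c') <= 4] and [e x^2 <= a + 1]; it serves only to keep integrals finite. *)
Lemma transport_sandwich (w w' c c' e x m V B a : R) :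
  0 <= w <= 1 -> - 4 <= c' <= 0 -> 0 <= e -> 0 <= B -> 0 <= a ->
  (c' != 0 -> e * x ^+ 2 <= a + 1 /\ `|m * V| <= B * `|x|) ->
  w' * c <= w' * c - w * c' * (2 * B) * (e * x ^+ 2) - m * (w * c' * e * (2 * x)) * V
    <= w' * c + 16 * B * (a + 1).
Proof.
move=> /andP[w0 w1] /andP[c'4 c'0] e0 B0 a0 H.
have [->|/H[exa mV]] := eqVneq c' 0.
  rewrite !(mulr0, mul0r) !subr0 lexx/= lerDl !mulr_ge0//.
  by rewrite addr_ge0.
have xmV : `|x * (m * V)| <= B * x ^+ 2.
  rewrite normrM -(real_normK (num_real x)) expr2 mulrCA.
  by rewrite ler_wpM2l.
move: xmV; rewrite ler_norml => /andP[xm1 xm2].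
have E : - (w * c' * (2 * B) * (e * x ^+ 2)) - m * (w * c' * e * (2 * x)) * V =
    (w * - c') * (e * (2 * (B * x ^+ 2 + x * (m * V)))) by ring.
rewrite -addrA {}E.
have wc : 0 <= w * - c' <= 4.
  rewrite mulr_ge0 ?oppr_ge0//=.
  have : w * - c' <= 1 * 4 by apply: ler_pM; rewrite ?oppr_ge0// lerNl.
  by rewrite mul1r.
have ee : 0 <= e * (2 * (B * x ^+ 2 + x * (m * V))) <= 4 * B * (a + 1).
  apply/andP; split.
    rewrite !mulr_ge0//; lra.
  apply: (@le_trans _ _ (e * (4 * (B * x ^+ 2)))).
    by rewrite ler_wpM2l//; lra.
  have -> : e * (4 * (B * x ^+ 2)) = 4 * B * (e * x ^+ 2) by ring.
  by rewrite ler_wpM2l// mulr_ge0.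
case/andP: wc => wc1 wc2; case/andP: ee => ee1 ee2.
rewrite lerDl mulr_ge0//= lerD2l.
apply: (le_trans (ler_pM wc1 ee1 wc2 ee2)).
by rewrite (_ : 16 = 4 * 4) ?mulrA// -natrM.
Qed.

End Drift.

(** Up to the factor [cutoff 0], the plateau of the other ramp, this is the lower bound for the time
    integrand when the inner mass is at least [c2] on the rise and at most [c1] on the fall. *)
Definition window_bound {R : realType} (dl t1 c1 c2 t : R) : R :=
  c2 * ramp' dl t - c1 * ramp' dl (t1 - t).

Section TimeIntegral.
Context {R : realType}.
Variables (dl t1 c1 c2 : R).
Hypotheses (dl0 : 0 < dl) (dlt : 4 * dl <= t1).
Notation u := (window_bound dl t1 c1 c2).

Let t10 : 0 < t1. Proof. by move: dl0 dlt; lra. Qed.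

Lemma continuous_window_bound : continuous u.
Proof.
move=> t; apply: cvgB; apply: cvgMr; first exact: continuous_ramp'.
apply: (@continuous_comp _ _ _ (fun t : R => t1 - t) (ramp' dl)); last exact: continuous_ramp'.
by apply: cvgB; [exact: cvg_cst|exact: cvg_id].
Qed.

Lemma integrable_window_bound :
  lebesgue_measure.-integrable `]0, t1] (EFin \o u).
Proof.
have ui : lebesgue_measure.-integrable `[0, t1] (EFin \o u).
  apply: continuous_compact_integrable; first exact: segment_compact.
  exact/continuous_subspaceT/continuous_window_bound.
by apply: integrableS ui => //; apply: subset_itvr; rewrite bnd_simp.
Qed.

Lemma Rintegral_window_bound :
  \int[lebesgue_measure]_(t in `]0, t1]) u t = cutoff 0 * (c2 - c1).
Proof.
rewrite Rintegral_itv_obnd_cbnd; last exact: integrable_window_bound.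
(* A primitive, equal to [c1 * cutoff 0] at 0 and to [c2 * cutoff 0] at [t1]. *)
pose F t := c2 * ramp dl t + c1 * ramp dl (t1 - t).
have dF (t : R) : is_derive t 1 F (u t).
  have d1 := is_derive_ramp dl t.
  have d2 : is_derive t 1 (fun s => ramp dl (t1 - s)) (ramp' dl (t1 - t) * -1).
    apply: (@is_derive1_comp _ (ramp dl) (fun s => t1 - s)).
      exact: is_derive_ramp.
    have := is_deriveB (is_derive_cst t1 t 1) (is_derive_id t 1).
    by rewrite sub0r.
  apply: (is_derive_eq (is_deriveD (is_deriveZ c2 d1) (is_deriveZ c1 d2))).
  rewrite /window_bound /GRing.scale/=.
  by move: (ramp' _ _) (ramp' _ _) => a b; ring.
have cF : continuous F.
  by move=> t; apply/differentiable_continuous/derivable1_diffP; have [] := dF t.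
rewrite /Rintegral (@continuous_FTC2 _ u F 0 t1)//.
- have fineBE (v w : R) : fine (v%:E - w%:E)%E = v - w by [].
  rewrite fineBE /F (subrr t1) (subr0 t1).
  rewrite !(ramp_ge (t := t1))// ?(ramp_le (t := 0))//; first by ring.
  + exact: ltW.
  + by move: dl0 dlt; lra.
- exact/continuous_subspaceT/continuous_window_bound.
- split.
  + by move=> t _; have [] := dF t.
  + exact/cvg_at_right_filter/cF.
  + exact/cvg_at_left_filter/cF.
- by move=> t _; rewrite derive1E; have [] := dF t.
Qed.

End TimeIntegral.

(** * Conservation of the mass behind the front *)

Section Barriers.
Context {R : realType} {n : nat}.
Variables (m p : 'I_n -> R) (E : R) (W : R -> 'M[R]_n).
Variable mu : R -> 'I_n -> borelMeasure R.
Hypothesis ph : forall t, 0 <= t -> phase_space m p E (mu t).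

Lemma integrable_cutoff_sqr (nu : borelMeasure R) (q c a : R) : nu setT = q%:E ->
  nu.-integrable setT (EFin \o (fun x : R => cutoff (c * x ^+ 2 - a))).
Proof.
move=> nuq; apply: (integrable_dominated _ (integrable_cst_mass 1 nuq)).
  by apply: continuous_measurable_fun; exact: continuous_cutoff_sqr.
by move=> x; rewrite ger0_norm ?cutoff_ge0// cutoff_le1.
Qed.

(** Smoothed mass behind the front, scaled by the plateau: all mass behind the front corresponds to
    the value [cutoff 0 * p i]. *)
Definition inner_mass (B a t : R) (i : 'I_n) : R :=
  \int[mu t i]_x cutoff (decay B t * x ^+ 2 - a).

(** Since [4 * dl <= t1], each ramp varies only where the other has reached its plateau. *)
Lemma window_inner_mass_ge (i : 'I_n) (dl t1 t B a c1 c2 : R) :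
  0 < dl -> 4 * dl <= t1 -> 0 <= t ->
  (forall s, 0 <= s -> s <= 2 * dl -> c2 <= inner_mass B a s i) ->
  (forall s, 0 <= s -> t1 - 2 * dl <= s -> s <= t1 -> inner_mass B a s i <= c1) ->
  cutoff 0 * window_bound dl t1 c1 c2 t <= window' dl t1 t * inner_mass B a t i.
Proof.
move=> dl0 dlt t0 lo hi; rewrite /window_bound /window' mulrBr mulrBl lerB//.
- have [/andP[h1 h2]|h] := boolP (dl < t < 2 * dl); last first.
    by rewrite (ramp'_out dl0 h) !(mulr0, mul0r).
  rewrite (@ramp_ge _ dl (t1 - t))//; last by move: dlt h2; lra.
  rewrite mulrCA mulrA -mulrA mulrCA (mulrC (cutoff 0)) -!mulrA.
  rewrite mulrCA ler_wpM2l ?ramp'_ge0// mulrC ler_wpM2l ?cutoff_ge0//.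
  by apply: lo => //; exact: ltW.
- have [/andP[h1 h2]|h] := boolP (dl < t1 - t < 2 * dl); last first.
    by rewrite (ramp'_out dl0 h) !(mulr0, mul0r).
  rewrite (@ramp_ge _ dl t)//; last by move: dlt h2; lra.
  rewrite -mulrA ler_wpM2l ?cutoff_ge0// mulrC ler_wpM2r ?ramp'_ge0//.
  by apply: hi => //; move: h1 h2 dl0; lra.
Qed.

(* The time window rises where the inner mass is at least [c2] and falls where it
   is at most [c1]. The time integrand [G] is only compared with continuous bounds,
   so its measurability is never needed. *)
Lemma barrier_estimate (i : 'I_n) (dl t1 B a c1 c2 : R) :
  weak_solution m W mu ->
  0 < dl -> 4 * dl <= t1 -> 0 <= B -> 0 <= a ->
  (forall t x, 0 <= t -> t <= t1 -> a < decay B t * x ^+ 2 ->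
    `|m i * drift W (mu t) i x| <= B * `|x|) ->
  (forall s, 0 <= s -> s <= 2 * dl -> c2 <= inner_mass B a s i) ->
  (forall s, 0 <= s -> t1 - 2 * dl <= s -> s <= t1 -> inner_mass B a s i <= c1) ->
  c2 <= c1.
Proof.
move=> Hweak dl0 dlt B0 a0 Hv lo hi.
pose phi := barrier dl t1 B a.
pose G (t : R) : R := \int[mu t i]_x
  (dt phi (t, x) - m i * dx phi (t, x) * drift W (mu t) i x).
have HG : \int[lebesgue_measure]_(t in `]0, +oo[) G t = 0.
  exact: Hweak i _ (test_function_barrier t1 dl0 B0 a0).
have GE t : G t = \int[mu t i]_x
    (window' dl t1 t * cutoff (decay B t * x ^+ 2 - a) -
     window dl t1 t * cutoff' (decay B t * x ^+ 2 - a) * (2 * B) * (decay B t * x ^+ 2) -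
     m i * (window dl t1 t * cutoff' (decay B t * x ^+ 2 - a) * decay B t * (2 * x)) *
     drift W (mu t) i x).
  by apply: eq_Rintegral => x _; rewrite dt_barrier dx_barrier.
(* The window vanishes after [t1], so the weak equation becomes an integral over a bounded interval,
   where constants are integrable. *)
have Gout t : t1 < t -> G t = 0.
  move=> t1t; rewrite GE /window /window'.
  have t1tdl : t1 - t <= dl by move: t1t dl0; lra.
  rewrite (ramp_le dl0 t1tdl) (ramp'_out (t := t1 - t))//; last first.
    by rewrite negb_and -!leNgt t1tdl.
  rewrite !mulr0 subrr /Rintegral integral0_eq// => x _.
  by rewrite !(mul0r, mulr0) subrr subr0.
have {}HG : \int[lebesgue_measure]_(t in `]0, t1]) G t = 0.
  rewrite -[RHS]HG Rintegral_mkcond [RHS]Rintegral_mkcond; congr Rintegral.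
  apply/funext => t; rewrite /patch.
  case: ifPn => [|]; rewrite ?inE ?notin_setE/= in_itv/=.
    by move=> /andP[t0 tt1]; rewrite ifT// inE/= in_itv/= t0.
  move=> H; case: ifPn => //; rewrite inE/= in_itv/= andbT => t0.
  by rewrite Gout// ltNge; apply/negP => tt1; apply: H; rewrite t0.
(* The first term dominates [window'], the second the transport terms. *)
pose K := 8 / dl + 16 * B * (a + 1).
have K0 : 0 <= K by rewrite addr_ge0 ?divr_ge0 ?mulr_ge0 ?addr_ge0// ltW.
have Gb t : 0 < t -> t <= t1 ->
    cutoff 0 * window_bound dl t1 c1 c2 t <= G t <= K * p i.
  move=> t0 tt1; have mup := ps_mass (ph (ltW t0)) i.
  have w01 : 0 <= window dl t1 t <= 1.
    rewrite /window mulr_ge0 ?ramp_ge0//=.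
    by rewrite -[leRHS]mulr1; apply: ler_pM; rewrite ?ramp_ge0 ?ramp_le1.
  have w'b : window' dl t1 t <= 8 / dl.
    have h1 : ramp' dl t * ramp dl (t1 - t) <= 4 / dl * 1.
      by apply: ler_pM; rewrite ?ramp'_ge0 ?ramp_ge0 ?ramp'_le ?ramp_le1.
    have h2 : 0 <= ramp dl t * ramp' dl (t1 - t).
      by rewrite mulr_ge0 ?ramp_ge0 ?ramp'_ge0.
    rewrite /window'; apply: (@le_trans _ _ (4 / dl)).
      by rewrite lerBlDr (le_trans h1)// mulr1 lerDl.
    by rewrite ler_wpM2r ?invr_ge0 ?ler_nat// ltW.
  pose h (x : R) := window' dl t1 t * cutoff (decay B t * x ^+ 2 - a).
  pose g (x : R) := h x -
    window dl t1 t * cutoff' (decay B t * x ^+ 2 - a) * (2 * B) * (decay B t * x ^+ 2) -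
    m i * (window dl t1 t * cutoff' (decay B t * x ^+ 2 - a) * decay B t * (2 * x)) *
    drift W (mu t) i x.
  have tb (x : R) : h x <= g x <= h x + 16 * B * (a + 1).
    apply: transport_sandwich => //.
    - by rewrite cutoff'_geN4 cutoff'_le0.
    - exact: expR_ge0.
    move=> c'0; have [/andP[y0 y1]|/cutoff'_out c'E] :=
      boolP (0 < decay B t * x ^+ 2 - a < 1); last by rewrite c'E eqxx in c'0.
    split; first by move: y1; lra.
    by apply: Hv => //; [exact: ltW|move: y0; lra].
  have gK (x : R) : g x <= K.
    have /andP[_ g2] := tb x; apply: (le_trans g2); rewrite /K lerD2r.
    apply: (@le_trans _ _ (8 / dl * cutoff (decay B t * x ^+ 2 - a))).
      by rewrite /h ler_wpM2r ?cutoff_ge0.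
    by rewrite ler_piMr ?cutoff_le1// divr_ge0// ltW.
  have hg (x : R) : h x <= g x by have /andP[] := tb x.
  have fi := integrable_cutoff_sqr (decay B t) a mup.
  have hi' : (mu t i).-integrable setT (EFin \o h).
    exact: (integrableZl measurableT (window' dl t1 t) fi).
  have /andP[g1 g2] := le_Rintegral_sandwich measurableT hi'
    (integrable_cst_mass K mup) (fun x _ => hg x) (fun x _ => gK x).
  rewrite GE; apply/andP; split; last first.
    by apply: (le_trans g2); rewrite Rintegral_cst// mup.
  apply: le_trans g1; rewrite /h RintegralZl//.
  by apply: window_inner_mass_ge => //; exact: ltW.
have ik : lebesgue_measure.-integrable `]0, t1] (EFin \o cst (K * p i)).
  have ci : lebesgue_measure.-integrable `[0, t1] (EFin \o cst (K * p i)).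
    apply: continuous_compact_integrable; first exact: segment_compact.
    by apply: continuous_subspaceT => x; exact: cst_continuous.
  by apply: integrableS ci => //; apply: subset_itvr; rewrite bnd_simp.
have iu : lebesgue_measure.-integrable `]0, t1]
    (EFin \o (fun t => cutoff 0 * window_bound dl t1 c1 c2 t)).
  have ib := integrable_window_bound dl t1 c1 c2.
  exact: (integrableZl _ (cutoff 0) ib).
have Gl (t : R) : `]0, t1]%classic t -> cutoff 0 * window_bound dl t1 c1 c2 t <= G t.
  by rewrite /= in_itv/= => /andP[t0 tt1]; have /andP[] := Gb t t0 tt1.
have Gr (t : R) : `]0, t1]%classic t -> G t <= K * p i.
  by rewrite /= in_itv/= => /andP[t0 tt1]; have /andP[] := Gb t t0 tt1.
have /andP[+ _] := @le_Rintegral_sandwich _ _ _ lebesgue_measure _ _ G _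
  (measurable_itv `]0, t1]) iu ik Gl Gr.
rewrite HG RintegralZl//; last exact: integrable_window_bound.
(* The lower bound integrates to [(cutoff 0)^2 (c2 - c1)], while the integral of [G] is 0. *)
rewrite Rintegral_window_bound// mulrA pmulr_rle0 ?mulr_gt0 ?cutoff0_gt0//.
by rewrite subr_le0.
Qed.

End Barriers.

(** * From full inner mass to a null exterior *)

Section NullSets.
Context {R : realType}.
Variables (nu : borelMeasure R) (q : R).
Hypothesis nuq : nu setT = q%:E.

Lemma le_Rintegral_null (r : R) (f g : R -> R) :
  nu [set x | r < `|x|] = 0%E ->
  nu.-integrable setT (EFin \o f) -> nu.-integrable setT (EFin \o g) ->
  (forall x, 0 <= f x) -> (forall x, 0 <= g x) ->
  (forall x, `|x| <= r -> f x <= g x) ->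
  \int[nu]_x f x <= \int[nu]_x g x.
Proof.
move=> nu0 fi gi f0 g0 fg; rewrite /Rintegral; apply: fine_le.
- exact: (integrable_fin_num measurableT fi).
- exact: (integrable_fin_num measurableT gi).
apply: ae_ge0_le_integral => //.
- by move=> x _; rewrite lee_fin.
- by case/integrableP: fi.
- by move=> x _; rewrite lee_fin.
- by case/integrableP: gi.
exists [set x | r < `|x|]; split => //; first exact: measurable_norm_gt.
move=> x /= H; rewrite ltNge; apply/negP => xr; apply: H => _.
by rewrite lee_fin fg.
Qed.

(** The deficit [cutoff 0 - cutoff] is nonnegative with nonpositive integral, hence zero almost
    everywhere. As [cutoff] drops strictly below its plateau right after 0, the null set reaches
    exactly to the front, with no loss across the transition layer. *)
Lemma null_of_full_mass (c a : R) :
  cutoff 0 * q <= \int[nu]_x cutoff (c * x ^+ 2 - a) ->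
  nu.-negligible [set x | a < c * x ^+ 2].
Proof.
move=> H.
pose f (x : R) : R := cutoff 0 - cutoff (c * x ^+ 2 - a).
have f0 x : 0 <= f x by rewrite subr_ge0 cutoff_le_cutoff0.
have ic := integrable_cst_mass (cutoff 0) nuq.
have ig := integrable_cutoff_sqr c a nuq.
have fi : nu.-integrable setT (EFin \o f) := integrableB measurableT ic ig.
have fE : \int[nu]_x f x <= 0.
  have -> : \int[nu]_x f x = \int[nu]_x cutoff 0 -
      \int[nu]_x cutoff (c * x ^+ 2 - a) := RintegralB measurableT ic ig.
  by rewrite subr_le0 [leLHS]Rintegral_cst// nuq.
have F0 : (\int[nu]_x `|(f x)%:E| = 0)%E.
  apply/eqP; rewrite eq_le integral_ge0// andbT.
  have -> : (\int[nu]_x `|(f x)%:E| = \int[nu]_x (f x)%:E)%E.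
    by apply: eq_integral => x _; rewrite gee0_abs// lee_fin.
  by rewrite -[leLHS]fineK ?(integrable_fin_num measurableT fi)// lee_fin.
have mf : measurable_fun setT (EFin \o f) by case/integrableP: fi.
have [N [mN N0 HN]] := (ae_eq_integral_abs nu measurableT mf).1 F0.
exists N; split => // x /= ax; apply: HN => /= /(_ I) [].
apply/eqP; rewrite gt_eqF// subr_gt0; apply: cutoff_lt.
by rewrite subr_gt0.
Qed.

End NullSets.

Section Front.
Context {R : realType}.

Lemma front_lt (B t s x : R) : 0 <= s ->
  (s ^+ 2 < decay B t * x ^+ 2) = (s * expR (B * t) < `|x|).
Proof.
move=> s0; rewrite /decay mulNr expRN mulrC ltr_pdivlMr ?expR_gt0//.
have -> : expR (2 * B * t) = expR (B * t) ^+ 2.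
  by rewrite expr2 -expRD; congr expR; ring.
rewrite -exprMn -(real_normK (num_real x)) ltr_sqr ?nnegrE// mulr_ge0// expR_ge0.
Qed.

End Front.

Section Conservation.
Context {R : realType} {n : nat}.
Variables (m p : 'I_n -> R) (E : R) (W : R -> 'M[R]_n).
Hypotheses (hm : forall i, 0 < m i) (hp : forall i, 0 < p i).
Variables (mu : R -> 'I_n -> borelMeasure R) (T : R).
Hypotheses (hT : 0 < T) (hAC : AC2_loc (phase_space m p E) (WP m) mu).
Hypothesis hweak : weak_solution m W mu.

(** A deficit [3 * e] at [t1] is contradictory: near 0 the inner mass is within [e] of full, near
    [t1] it exceeds its final value by at most [e], and the barrier estimate then gives
    [3 * e <= 2 * e]. *)
Lemma inner_mass_conserved (i : 'I_n) (B a t1 : R) :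
  0 <= B -> 0 <= a -> 0 <= t1 -> t1 <= T ->
  (forall t x, 0 <= t -> t <= t1 -> a < decay B t * x ^+ 2 ->
    `|m i * drift W (mu t) i x| <= B * `|x|) ->
  cutoff 0 * p i <= inner_mass mu B a 0 i ->
  cutoff 0 * p i <= inner_mass mu B a t1 i.
Proof.
move=> B0 a0 t10 t1T Hv H0.
have [ph _] := hAC.
move: t10; rewrite le_eqVlt => /predU1P[<-//|t10].
rewrite leNgt; apply/negP => Hlt.
pose e := (cutoff 0 * p i - inner_mass mu B a t1 i) / 3.
have e0 : 0 < e by rewrite divr_gt0// subr_gt0.
(* Continuity in time is known for a fixed integrand only, so the factor [decay] is frozen, at 0 for
   the initial window and at [t1] for the final one. *)
have modulus (c : R) : 0 < c -> exists2 d : R, 0 < d & forall s t,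
    0 <= s -> s <= t -> t <= T -> t - s <= d ->
    `|\int[mu s i]_x cutoff (c * x ^+ 2 - a) - \int[mu t i]_x cutoff (c * x ^+ 2 - a)| <= e.
  move=> c0.
  apply: (integral_lipschitz_modulus hm hp hT hAC (C := 8 * (c + a + 1)) (c := 1)) => //.
  - by rewrite mulr_gt0// ltr_wpDl// addr_ge0// ltW.
  - by apply: continuous_measurable_fun; exact: continuous_cutoff_sqr.
  - by move=> x; rewrite ger0_norm ?cutoff_ge0// cutoff_le1.
  - by move=> x y; exact: cutoff_sqr_lipschitz.
have [d0 d00 Hd0] := modulus (decay B 0) (expR_gt0 _).
have [d1 d10 Hd1] := modulus (decay B t1) (expR_gt0 _).
(* The cutoff region expands, so unfreezing [decay] changes the integral in the favourable direction
   at both ends. *)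
have mono (s t : R) : 0 <= s -> s <= t ->
    forall x : R, cutoff (decay B s * x ^+ 2 - a) <= cutoff (decay B t * x ^+ 2 - a).
  move=> s0 st x; apply: cutoff_nincr; rewrite lerD2r ler_wpM2r ?sqr_ge0//.
  by rewrite ler_expR !mulNr lerN2 ler_wpM2l// mulr_ge0.
(* The first entry separates the ramps; the others keep times within [2 * dl] of either end inside
   the moduli. *)
pose dl := Num.min (t1 / 4) (Num.min (d0 / 2) (d1 / 2)).
have dl0 : 0 < dl by rewrite !lt_min !divr_gt0.
have dl1 : 4 * dl <= t1.
  by rewrite mulrC -ler_pdivlMr// ge_min lexx.
have dl2 : 2 * dl <= d0.
  by rewrite mulrC -ler_pdivlMr// !ge_min lexx orbT.
have dl3 : 2 * dl <= d1.
  by rewrite mulrC -ler_pdivlMr// !ge_min lexx !orbT.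
have lo (s : R) : 0 <= s -> s <= 2 * dl -> cutoff 0 * p i - e <= inner_mass mu B a s i.
  move=> s0 sdl.
  have sT : s <= T by move: sdl dl1 t1T dl0; lra.
  have sd0 : s - 0 <= d0 by rewrite subr0 (le_trans sdl).
  have := Hd0 0 s (lexx _) s0 sT sd0; rewrite ler_norml => /andP[_ h1].
  have sm := ps_mass (ph s s0) i.
  have h2 : \int[mu s i]_x cutoff (decay B 0 * x ^+ 2 - a) <= inner_mass mu B a s i.
    exact: (le_Rintegral measurableT (integrable_cutoff_sqr (decay B 0) a sm)
      (integrable_cutoff_sqr (decay B s) a sm) (fun x _ => mono 0 s (lexx _) s0 x)).
  move: H0 h1 h2; rewrite {1}/inner_mass; lra.
have hi (s : R) : 0 <= s -> t1 - 2 * dl <= s -> s <= t1 ->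
    inner_mass mu B a s i <= inner_mass mu B a t1 i + e.
  move=> s0 sdl st1.
  have sd1 : t1 - s <= d1 by rewrite (le_trans _ dl3)// lerBlDr -lerBlDl.
  have := Hd1 s t1 s0 st1 t1T sd1; rewrite ler_norml => /andP[_ h1].
  have sm := ps_mass (ph s s0) i.
  have h2 : inner_mass mu B a s i <= \int[mu s i]_x cutoff (decay B t1 * x ^+ 2 - a).
    exact: (le_Rintegral measurableT (integrable_cutoff_sqr (decay B s) a sm)
      (integrable_cutoff_sqr (decay B t1) a sm) (fun x _ => mono s t1 s0 st1 x)).
  move: h1 h2; rewrite -[X in _ - X <= e]/(inner_mass mu B a t1 i); lra.
have := barrier_estimate ph hweak dl0 dl1 B0 a0 Hv lo hi.
have e3 : 3 * e = cutoff 0 * p i - inner_mass mu B a t1 i.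
  by rewrite /e mulrC divfK.
move: e0 e3; lra.
Qed.

End Conservation.

(** * Propagation of supports *)

(** Starting from [1 + M] rather than [M] keeps the front at least 1, which absorbs the constant in
    the linear growth of [W_ij']. *)
Definition front {R : realType} (M B t : R) : R := (1 + M) * expR (B * t).

Section Propagation.
Context {R : realType} {n : nat}.
Variables (m p : 'I_n -> R) (E : R) (W : R -> 'M[R]_n).
Hypotheses (hm : forall i, 0 < m i) (hp : forall i, 0 < p i).
Variables (mu : R -> 'I_n -> borelMeasure R) (T : R).
Hypotheses (hT : 0 < T) (hAC : AC2_loc (phase_space m p E) (WP m) mu).
Hypothesis hweak : weak_solution m W mu.
Variables (C M B : R).
Hypotheses (C0 : 0 <= C) (M0 : 0 <= M).
Hypothesis HC : forall i j z, `|derive1 (fun y => W y i j) z| <= C * (1 + `|z|).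
Hypothesis HM : forall i, mu 0 i [set x | M < `|x|] = 0%E.
Hypothesis HB : forall i, 4 * (m i * (C * \sum_j p j)) <= B.

Notation Phi := (front M B).

Lemma propagation_step (th lam : R) : 1 <= th -> lam <= 2 * th ->
  (forall t j, 0 <= t -> t <= T -> \int[mu t j]_y `|y| <= p j * (lam * Phi t)) ->
  forall t i, 0 <= t -> t <= T -> mu t i [set x | th * Phi t < `|x|] = 0%E.
Proof.
move=> th1 lamth Hmom t i t0 tT.
have [ph _] := hAC.
have B0 : 0 <= B.
  apply: le_trans (HB i); rewrite !mulr_ge0 ?(ltW (hm i))//.
  by apply: sumr_ge0 => j _; exact: ltW.
have th0 : 0 <= th by exact: le_trans th1.
have s0 : 0 <= th * (1 + M) by rewrite mulr_ge0// addr_ge0.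
have PhiE s : th * Phi s = th * (1 + M) * expR (B * s) by rewrite /front mulrA.
have Phi1 s : 0 <= s -> 1 <= Phi s.
  move=> s_ge0; rewrite -[leLHS]mulr1; apply: ler_pM => //; first by rewrite lerDl.
  by rewrite -expR0 ler_expR mulr_ge0.
pose a := (th * (1 + M)) ^+ 2.
have Hv s x : 0 <= s -> s <= t -> a < decay B s * x ^+ 2 ->
    `|m i * drift W (mu s) i x| <= B * `|x|.
  move=> s_ge0 st; rewrite front_lt// -PhiE => Hx.
  have P1 := Phi1 s s_ge0.
  have P2 : Phi s <= th * Phi s by rewrite ler_peMl// (le_trans _ P1).
  have P3 : lam * Phi s <= 2 * (th * Phi s).
    by rewrite mulrA ler_wpM2r// (le_trans _ P1).
  have ps := ph s s_ge0.
  have := @drift_bound R n W p (fun j => p j * (lam * Phi s)) C (mu s) i x C0 HC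
    (ps_mass ps) (ps_moment2 ps) (fun j => Hmom s j s_ge0 (le_trans st tT)).
  have -> : \sum_j C * ((1 + `|x|) * p j + p j * (lam * Phi s)) =
      C * (\sum_j p j) * (1 + `|x| + lam * Phi s).
    rewrite mulr_sumr mulr_suml; apply: eq_bigr => j _; ring.
  move=> D; rewrite normrM (gtr0_norm (hm i)).
  have S0 : 0 <= C * \sum_j p j.
    by rewrite mulr_ge0//; apply: sumr_ge0 => j _; exact: ltW.
  (* Origin of the 4 in [B]: beyond the front 1 is at most [|x|], and
     [lam * Phi s <= 2 * (th * Phi s)] is at most [2 |x|]. *)
  have x4 : 1 + `|x| + lam * Phi s <= 4 * `|x| by move: P1 P2 P3 Hx; lra.
  have D' := le_trans D (ler_wpM2l S0 x4).
  apply: (le_trans (ler_wpM2l (ltW (hm i)) D')).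
  apply: le_trans (ler_wpM2r (normr_ge0 x) (HB i)).
  by rewrite le_eqVlt; apply/orP; left; apply/eqP; ring.
(* At time 0 the front [th * (1 + M)] already encloses the radius [M], so the inner mass is full. *)
have H0 : cutoff 0 * p i <= inner_mass mu B a 0 i.
  have mp := ps_mass (ph 0 (lexx _)) i.
  have -> : cutoff 0 * p i = \int[mu 0 i]_x cutoff 0 by rewrite [RHS]Rintegral_cst// mp.
  apply: (le_Rintegral_null (HM i) (integrable_cst_mass _ mp) (integrable_cutoff_sqr _ _ mp)).
  - by move=> x; exact: cutoff_ge0.
  - by move=> x; exact: cutoff_ge0.
  move=> x xM; rewrite [cutoff (_ - _)]cutoff_le0// subr_le0 leNgt front_lt// -leNgt.
  rewrite mulr0 expR0 mulr1 (le_trans xM)//.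
  by rewrite (@le_trans _ _ (1 + M))// ?lerDr// ler_peMl// addr_ge0.
have Hfull := inner_mass_conserved hm hp hT hAC hweak B0 (sqr_ge0 _) t0 tT Hv H0.
have := null_of_full_mass (ps_mass (ph t t0) i) Hfull.
have -> : [set x : R | a < decay B t * x ^+ 2] = [set x | th * Phi t < `|x|].
  by apply/seteqP; split => x /=; rewrite front_lt// PhiE.
by move=> /(measure_negligible (measurable_norm_gt _)).
Qed.

Lemma propagation (k : nat) :
  (forall t j, 0 <= t -> t <= T -> \int[mu t j]_y `|y| <= p j * (2 ^+ k * Phi t)) ->
  forall t i, 0 <= t -> t <= T -> mu t i [set x | Phi t < `|x|] = 0%E.
Proof.
have [ph _] := hAC.
elim: k => [|k IH] Hmom t i t0 tT.
  have le12 : (1 : R) <= 2 * 1 by rewrite mulr1 ler1n.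
  have := @propagation_step 1 1 (lexx 1) le12 _ t i t0 tT; rewrite mul1r; apply.
  by move=> s j s0 sT; have := Hmom s j s0 sT; rewrite expr0.
apply: IH => // s j s0 sT.
have th1 : 1 <= 2 ^+ k :> R by rewrite exprn_ege1// ler1n.
have Phi0 : 0 <= Phi s by rewrite mulr_ge0 ?expR_ge0 ?addr_ge0.
(* Here [th = 2 ^+ k]: the support bound costs half of [lam] and gives back the moment hypothesis
   with exponent [k], for the same [B]. *)
have null := propagation_step th1 (lexx _) (lam := 2 * 2 ^+ k).
have {}null := null _ s j s0 sT.
have ps := ph s s0.
have -> : p j * (2 ^+ k * Phi s) = \int[mu s j]_x (2 ^+ k * Phi s).
  by rewrite [RHS]Rintegral_cst// (ps_mass ps) mulrC.
apply: (le_Rintegral_null (null _) (integrable_normr (ps_mass ps j) (ps_moment2 ps j))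
  (integrable_cst_mass _ (ps_mass ps j))) => //.
- by move=> u l u0 uT; rewrite -exprS; exact: Hmom.
- by move=> x; rewrite /= mulr_ge0// exprn_ge0.
Qed.

End Propagation.

Theorem proposition3p1 (R : realType) (n : nat) (m p : 'I_n -> R) (E : R)
    (hm : forall i, 0 < m i) (hp : forall i, 0 < p i)
    (W : R -> 'M[R]_n) (hW : admissible W)
    (mu0 : 'I_n -> borelMeasure R) (hmu0 : phase_space m p E mu0)
    (hsupp : forall i, compact (supp (mu0 i)))
    (T : R) (hT : 0 < T) :
  exists2 K : R, 0 < K &
    forall mu : R -> 'I_n -> borelMeasure R, gradient_flow m p E W mu0 mu ->
      forall (t : R) (i : 'I_n), 0 <= t -> t <= T ->
        supp (mu t i) `<=` `[- K, K].
Proof.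
have [C C0 HC] := admissible_derive1_bound hW.
have /choice[r Hr] : forall i, exists r : R, 0 <= r /\ mu0 i [set x | r < `|x|] = 0%E.
  by move=> i; have [r r0 Hr] := supp_bounded_null (hsupp i); exists r.
pose M := \sum_i r i.
have M0 : 0 <= M by apply: sumr_ge0 => i _; have [] := Hr i.
(* Summing the mobilities gives one rate valid for every component. *)
pose B := 4 * ((\sum_i m i) * (C * \sum_j p j)).
have P0 : 0 <= C * \sum_j p j.
  by rewrite mulr_ge0//; apply: sumr_ge0 => j _; exact: ltW.
have B0 : 0 <= B.
  by rewrite !mulr_ge0//; apply: sumr_ge0 => j _; exact: ltW.
have HB i : 4 * (m i * (C * \sum_j p j)) <= B.
  rewrite ler_wpM2l// ler_wpM2r// (bigD1 i)//= lerDl.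
  by apply: sumr_ge0 => j _; exact: ltW.
have M1 : 0 < 1 + M by rewrite ltr_wpDr.
(* The front at time [T], built from the data alone and chosen before [mu] is introduced. *)
exists ((1 + M) * expR (B * T)); first by rewrite mulr_gt0// expR_gt0.
move=> mu [hAC hinit hweak] t i t0 tT x /= sx.
have HM j : mu 0 j [set x | M < `|x|] = 0%E.
  rewrite hinit; last exact: measurable_norm_gt.
  have [_ H] := Hr j; apply: subset_measure0 H; try exact: measurable_norm_gt.
  move=> y /=; apply: le_lt_trans; rewrite /M (bigD1 j)//= lerDl.
  by apply: sumr_ge0 => l _; have [] := Hr l.
have [L L0 HL] := first_moment_bounded hm hp hT hAC.
have [k Lk] : exists k : nat, L <= 2 ^+ k.
  exists (Num.truncn L).+1.
  rewrite (le_trans (ltW (truncnS_gt L)))// -natrX ler_nat.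
  by rewrite ltnW// ltn_expl.
have null : mu t i [set x | (1 + M) * expR (B * t) < `|x|] = 0%E.
  apply: (@propagation _ _ m p E W hm hp mu T hT hAC hweak C M B C0 M0 HC HM HB k) => //.
  move=> s j s0 sT; apply: (le_trans (HL s j _)); first by rewrite s0.
  apply: ler_wpM2l; first exact: ltW.
  apply: (le_trans Lk); rewrite ler_peMr ?exprn_ge0//.
  rewrite -[leLHS]mulr1; apply: ler_pM => //; first by rewrite lerDl.
  by rewrite -expR0 ler_expR mulr_ge0.
(* A support point beyond [K] would lie beyond the nondecreasing front at time [t], in an open null
   set. *)
rewrite in_itv/= -ler_norml leNgt; apply/negP => xK.
have := sx [set y | (1 + M) * expR (B * t) < `|y|].
rewrite null ltxx => H; apply: (notF (H _)).
split.
  rewrite (_ : [set y | _] = (fun y : R => `|y|) @^-1` [set z | (1 + M) * expR (B * t) < z])//.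
  apply: open_comp; last exact: open_gt.
  by move=> y _; exact: norm_continuous.
rewrite /=; apply: le_lt_trans xK.
by rewrite ler_wpM2l ?(ltW M1)// ler_expR ler_wpM2l.
Qed.
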